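(* Consider the kl-UCB-4P algorithm with constant $c>0$. (i) For any non-profitable arm $a$ (i.e. $\mu_a<\tau_a$) and every $\epsilon\in(0,1)$, there exist positive quantities $H_1(\epsilon)$ and $\beta_1(\epsilon)$, depending only on $\epsilon,c_a^-,\mu_a,\tau_a$, such that for all $T$, $$\mathbb{E}[N_a(T)]\le (1+\epsilon)\frac{\tilde c_a^+(\log T+c\log\log T)}{c_a^-\,d(\mu_a,\tau_a)}+\tilde c_a^+\Big\{1+\frac{H_1(\epsilon)}{T^{\beta_1(\epsilon)}}\Big\}.$$ (ii) For any profitable arm $a$ (i.e. $\mu_a>\tau_a$), if $T\ge\max(3,c_a^+)$ and $c\ge 3$, then $$\tilde C_a(T)-\mathbb{E}[N_a(T)]\le \tilde c_a^+\{e(2c+3)\log\log T+c_a^++3\}.$$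
   Context: Profitable bandit setting: $K\ge 2$ arms; arm $a$ has reward distribution $\nu_a$ with mean $\mu_a$ and known threshold $\tau_a$. At each round $t\in\{1,\dots,T\}$, $C_a(t)$ clients of category $a$ arrive with $1\le c_a^-\le C_a(t)\le c_a^+<\infty$; the agent chooses $A_t\subseteq\{1,\dots,K\}$ and for each $a\in A_t$ observes $C_a(t)$ and rewards $X_{a,c,t}$, $1\le c\le C_a(t)$, i.i.d. $\sim\nu_a$; for each arm all variables $\{C_a(t),X_{a,c,t}\}$ are independent. $\tilde c_a^+\in[c_a^-,c_a^+]$ is an upper bound on $\mathbb{E}[C_a(t)]$ for all $t\le T$. $N_a(t)=\sum_{s=1}^t C_a(s)\mathbb{I}\{a\in A_s\}$, $\tilde C_a(T)=\mathbb{E}[\sum_{t=1}^T C_a(t)]$, and $\hat\mu_a(t)$ is the average of the $N_a(t)$ rewards observed from arm $a$ up to round $t$. Exponential family: all $\nu_a$ belong to a known one-dimensional canonical exponential family $\{\nu_\theta:\theta\in\Theta\}$, $\Theta$ an open interval, with densities $f_\theta(x)=A(x)\exp(x\theta-F(\theta))$ w.r.t. a reference measure, $F$ twice continuously differentiable, so $\theta\mapsto\mu(\theta)=\mathbb{E}_\theta[X]$ is strictly increasing. For means $x,y$, $d(x,y)=\mathrm{KL}(\nu_{\mu^{-1}(x)},\nu_{\mu^{-1}(y)})=F(\theta')-F(\theta)-F'(\theta)(\theta'-\theta)$ with $\theta=\mu^{-1}(x)$, $\theta'=\mu^{-1}(y)$. Index policy: $A_1=\{1,\dots,K\}$ and,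 for $t\ge1$, $A_{t+1}=\{a: u_a(t)\ge\tau_a\}$. kl-UCB-4P uses the index $u_a(t)=\sup\{q>\hat\mu_a(t): N_a(t)\,d(\hat\mu_a(t),q)\le\log t+c\log\log t\}$. *)

(* Defs.v *)
From HB Require Import structures.
From mathcomp Require Import all_boot all_order all_algebra.
From mathcomp Require Import all_classical all_reals all_analysis.

Set Implicit Arguments.
Unset Strict Implicit.
Unset Printing Implicit Defensive.

Import Order.TTheory GRing.Theory Num.Theory.
Import numFieldNormedType.Exports.
Local Open Scope classical_set_scope.
Local Open Scope ring_scope.

Section ExpFamily.
Context {R : realType}.
Variables (rho : {measure set R -> \bar R}) (Afun : R -> R)
  (th_lo th_hi : \bar R) (F : R -> R).

Definition Theta : set R := [set th | (th_lo < th%:E)%E /\ (th%:E < th_hi)%E].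

Definition ef_density (th : R) (x : R) : R := Afun x * expR (x * th - F th).

Definition ef_law (th : R) (B : set R) : \bar R :=
  (\int[rho]_(x in B) (ef_density th x)%:E)%E.

Definition ef_mean (th : R) : R :=
  fine (\int[rho]_x (x * ef_density th x)%:E)%E.

Definition mean_set : set R := ef_mean @` Theta.

Definition ef_mean_inv (x : R) : R := xget 0 [set th | Theta th /\ ef_mean th = x].

Definition exp_family_assumptions : Prop :=
  [/\ (th_lo < th_hi)%E,
      measurable_fun setT Afun,
      (forall x, 0 <= Afun x) &
   [/\
      (forall th, Theta th -> ((\int[rho]_x (ef_density th x)%:E) = 1)%E),
      (forall th, Theta th -> rho.-integrable setT (fun x => (x * ef_density th x)%:E)),
      (forall th, Theta th ->
         [/\ derivable F th 1, derivable (derive1 F) th 1 & ({for th, continuous (derive1n 2 F)})]) &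
      {in Theta &, {mono ef_mean : a b / a < b}}]].

(* d(x,y) = KL(nu_{mu^{-1} x}, nu_{mu^{-1} y})
         = F(th') - F(th) - F'(th)(th' - th),  th = mu^{-1}(x), th' = mu^{-1}(y),
   for x, y in mu(Theta).  For x outside mu(Theta) (e.g. an empirical mean on
   the boundary of the mean space), we use the standard extension
   sup_{t in Theta} (x t - F t) - (x th' - F th'), which agrees with the
   formula above on mu(Theta) and gives +oo where the KL is infinite. *)
Definition kl_div (x y : R) : R :=
  let th := ef_mean_inv x in
  let th' := ef_mean_inv y in
  F th' - F th - derive1 F th * (th' - th).

Definition kl_d (x y : R) : \bar R :=
  let th' := ef_mean_inv y in
  if `[< mean_set x >] then (kl_div x y)%:E
  else
    (ereal_sup [set (x * t - F t)%:E | t in Theta] - (x * th' - F th')%:E)%E.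

(* kl-UCB-4P index:
   u = sup { q > muhat : n d(muhat, q) <= log t + c log log t },
   q ranging over the mean space; the supremum of the empty set is taken to
   be muhat (the set is an interval starting at muhat). *)
Definition klucb4p_index (c : R) (n : nat) (muhat : R) (t : nat) : \bar R :=
  ereal_sup ([set muhat%:E] `|`
    [set q%:E | q in [set q | mean_set q /\ muhat < q /\
        (n%:R%:E * kl_d muhat q <= (ln t%:R + c * ln (ln t%:R))%:E)%E]]).

End ExpFamily.

(*  Cw t   : number of clients of the arm at round t (t >= 1)               *)
(*  Xw k t : reward of the k-th client (k >= 1) at round t                  *)
(*  u n m t: index of the arm after t rounds, given N = n and muhat = m     *)
(* stats t = (N(t), sum of the N(t) observed rewards).                      *)
(* The arm is in A_1; for t >= 1 it is in A_{t+1} iff u(t) >= tau.          *)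
(* Since the index of an arm only depends on that arm's observations, the   *)
(* membership a \in A_t is computed arm by arm.                             *)
Section Dynamics.
Context {R : realType}.
Variables (u : nat -> R -> nat -> \bar R) (tau : R)
  (Cw : nat -> nat) (Xw : nat -> nat -> R).

Definition in_next (t : nat) (ns : nat * R) : bool :=
  (t == 0)%N || (tau%:E <= u ns.1 (ns.2 / ns.1%:R) t)%E.

Fixpoint arm_stats (t : nat) : nat * R :=
  match t with
  | 0 => (0%N, 0)
  | t'.+1 =>
      let ns := arm_stats t' in
      if in_next t' ns
      then ((ns.1 + Cw t)%N, ns.2 + \sum_(k < Cw t) Xw k.+1 t)
      else ns
  end.

(* a \in A_t, for t >= 1 *)
Definition in_A (t : nat) : bool := in_next t.-1 (arm_stats t.-1).

Definition arm_N (t : nat) : nat := (arm_stats t).1.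

Definition arm_muhat (t : nat) : R := (arm_stats t).2 / (arm_N t)%:R.

End Dynamics.

Definition mutually_independent {d} {T : measurableType d} {R : realType}
  (P : probability T R) {I : eqType} (Y : I -> T -> R) : Prop :=
  forall (J : seq I) (B : I -> set R), uniq J -> (forall i, measurable (B i)) ->
    P (\bigcap_(i in [set i | i \in J]) (Y i @^-1` B i)) =
    (\prod_(i <- J) P (Y i @^-1` B i))%E.

Definition profitable_bandit {d} {T : measurableType d} {R : realType}
  (rho : {measure set R -> \bar R}) (Afun : R -> R) (th_lo th_hi : \bar R)
  (F : R -> R) (P : probability T R) (K : nat)
  (theta : 'I_K -> R) (cm cp : 'I_K -> nat)
  (C : 'I_K -> nat -> T -> nat) (X : 'I_K -> nat -> nat -> T -> R) : Prop :=
  [/\ (2 <= K)%N,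
      (forall a, Theta th_lo th_hi (theta a)),
      (forall a, 1 <= cm a <= cp a)%N &
   [/\
      (forall a t w, (1 <= t)%N -> cm a <= C a t w <= cp a)%N,
      (forall a t, measurable_fun setT (fun w => (C a t w)%:R : R)),
      (forall a k t, measurable_fun setT (X a k t)),
      (forall a k t B, (1 <= k)%N -> (1 <= t)%N -> measurable B ->
         P (X a k t @^-1` B) = ef_law rho Afun F (theta a) B) &
      (* for each arm, {C_a(t), X_{a,k,t} : t, k >= 1} mutually independent
         (unused indices t = 0 / k = 0 are mapped to the constant 0) *)
      (forall a, mutually_independent P
         (fun i : (nat + nat * nat)%type => match i with
            | inl t => if (1 <= t)%N then fun w => (C a t w)%:R else fun=> 0
            | inr kt => if (1 <= kt.1)%N && (1 <= kt.2)%N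
                        then X a kt.1 kt.2 else fun=> 0 end))]].

Definition klucb4p_N {d} {T : measurableType d} {R : realType}
  (Afun : R -> R) (rho : {measure set R -> \bar R}) (th_lo th_hi : \bar R)
  (F : R -> R) (c : R) (K : nat) (tau : 'I_K -> R)
  (C : 'I_K -> nat -> T -> nat) (X : 'I_K -> nat -> nat -> T -> R)
  (a : 'I_K) (t : nat) (w : T) : nat :=
  arm_N (klucb4p_index rho Afun th_lo th_hi F c) (tau a)
    (fun s => C a s w) (fun k s => X a k s w) t.

(* Main.v *)
(* Everything rests on exponential tilting. Integrating
   e^y >= 1 + y against the density at [th] shows that the mean at [th] is a
   subgradient of the log-partition function [F] there, hence equals F'(th), and
   the divergence is a supremum over [s] of (s - t) x - (F s - F t). For
   lam = s - th, the process exp (lam S_t - N_t (F s - F th)) has expectation 1,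
   because the arm's choice at round t+1 is independent of the rewards of that
   round (pi-lambda theorem, then Tonelli).

   Profitable arms: a round is skipped only if N_t d(muhat_t, mu) exceeds
   delta = ln t + c ln ln t. Peeling N_t into geometric slices of ratio
   e^(1/delta) and applying Markov's inequality to one tilting per slice gives
   probability at most (delta ln (t c^+) + 1) e^(1 - delta), which is
   O(1 / (t ln t)) and sums to O(ln ln T).

   Non-profitable arms: after m > (1 + eps) (ln T + c ln ln T) / (c^- d(mu, tau))
   pulls, pulling the arm requires muhat_t >= r for a fixed r > mu. The
   potential exp (lam S_t - N_t (phi + kap)) is then at least 1, while it
   contracts by q = e^(- c^- kap) at each pull, so the expected number of such
   pulls is at most q^m / (1 - q). *)
Require Import Defs.
From HB Require Import structures.
From mathcomp Require Import all_boot all_order all_algebra.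
From mathcomp Require Import all_classical all_reals all_analysis.
From mathcomp Require Import measurable_realfun ring lra.
Import Order.TTheory GRing.Theory Num.Theory.
Import numFieldNormedType.Exports.
Local Open Scope classical_set_scope.
Local Open Scope ring_scope.

(** * Densities, case splits on an integer variable, Markov and continuity bounds *)

Section measure_complements.
Context {d : measure_display} {T : measurableType d} {R : realType}.

Import HBNNSimple.

(** Holds on simple functions by linearity, then passes to the limit by monotone convergence on both
    sides. It serves to integrate against [ef_law], which is known only through its values on
    sets. *)
Lemma ge0_integral_density (mu nu : {measure set T -> \bar R}) (f : T -> R)
    (g : T -> \bar R) :
  measurable_fun setT f -> (forall x, 0 <= f x) ->
  (forall B, measurable B -> nu B = \int[mu]_(x in B) (f x)%:E)%E ->
  measurable_fun setT g -> (forall x, 0 <= g x)%E ->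
  (\int[nu]_x g x = \int[mu]_x (g x * (f x)%:E))%E.
Proof.
move=> mf f0 nuE mg g0.
have mfE : measurable_fun setT (EFin \o f) by exact/measurable_EFinP.
pose g_ := nnsfun_approx measurableT mg.
have g_g x : (g_ n x)%:E @[n --> \oo] --> g x by exact: cvg_nnsfun_approx.
have nd_g x : {homo (fun n => (g_ n x)%:E) : m n / (m <= n)%N >-> (m <= n)%E}.
  by move=> m n mn; rewrite lee_fin; exact/lefP/nd_nnsfun_approx.
have nuI (h : {nnsfun T >-> R}) :
    (\int[nu]_x (h x)%:E = \int[mu]_x ((h x)%:E * (f x)%:E))%E.
  under [LHS]eq_integral do rewrite fimfunE -fsumEFin//.
  rewrite [LHS]ge0_integral_fsum//; last 2 first.
    - by move=> r; exact/measurable_EFinP/measurableT_comp.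
    - by move=> n x _; rewrite EFinM nnfun_muleindic_ge0.
  under [RHS]eq_integral.
    move=> x xD; rewrite fimfunE -fsumEFin// muleC ge0_mule_fsumr; last first.
      by move=> r; rewrite EFinM nnfun_muleindic_ge0.
    over.
  rewrite [RHS]ge0_integral_fsum//; last 2 first.
    - move=> r; apply: emeasurable_funM => //.
      by apply/measurable_EFinP; apply/measurableT_comp.
    - move=> n x _; apply: mule_ge0; first by rewrite lee_fin.
      by rewrite EFinM nnfun_muleindic_ge0.
  apply: eq_fsbigr => r rh.
  have r0 : 0 <= r by move: rh; rewrite inE => -[x _ <-].
  under [RHS]eq_integral do rewrite muleC EFinM -muleA.
  rewrite [LHS]integralZl_indic_nnsfun// integral_indic// setIT.
  rewrite [RHS]ge0_integralZl//; last 2 first.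
    - apply: emeasurable_funM => //.
      by apply/measurable_EFinP; exact: measurable_indic.
    - by move=> x _; rewrite mule_ge0 ?lee_fin.
  congr (_ * _)%E; rewrite nuE//.
  rewrite [LHS]integral_mkcond; apply: eq_integral => x _.
  by rewrite patchE indicE; case: ifPn => _; rewrite ?mul1e ?mul0e.
transitivity (limn (fun n => \int[nu]_x (g_ n x)%:E))%E.
  rewrite -monotone_convergence//=.
  - by apply: eq_integral => x _; apply/esym/cvg_lim => //; exact: g_g.
  - by move=> n; exact/measurable_EFinP.
  - by move=> n x _; rewrite lee_fin.
transitivity (limn (fun n => \int[mu]_x ((g_ n x)%:E * (f x)%:E)))%E; last first.
  rewrite -monotone_convergence//=.
  - apply: eq_integral => x _; apply/cvg_lim => //.
    by apply: cvgeZr => //; exact: g_g.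
  - by move=> n; apply: emeasurable_funM => //; exact/measurable_EFinP.
  - by move=> n x _; rewrite mule_ge0 ?lee_fin.
  - by move=> x _ m n mn; rewrite lee_wpmul2r ?lee_fin//; exact: (nd_g x).
by congr (limn _); apply/funext => n; exact: nuI.
Qed.

(** The preimage is a countable union over the values of [N]. This handles random sample sizes: sums
    over [C t] rewards and empirical means over [N t] of them. *)
Lemma measurable_fun_nat_case {d' : measure_display} {T' : measurableType d'}
    (N : T -> nat) (f : nat -> T -> T') :
  measurable_fun setT N -> (forall n, measurable_fun setT (f n)) ->
  measurable_fun setT (fun w => f (N w) w).
Proof.
move=> mN mf _ B mB; rewrite setTI.
have -> : (fun w => f (N w) w) @^-1` B =
    \bigcup_n (N @^-1` [set n] `&` f n @^-1` B).
  by apply/seteqP; split => [w fw|w [n _ [<-]]//]; exists (N w).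
apply: bigcupT_measurable => n; apply: measurableI.
  by rewrite -[X in measurable X]setTI; exact: mN.
by rewrite -[X in measurable X]setTI; exact: mf.
Qed.

Lemma measurable_fun_natr (N : T -> nat) :
  measurable_fun setT (fun w => (N w)%:R : R) <-> measurable_fun setT N.
Proof.
split=> [mN|mN]; last exact: (@measurable_fun_nat_case _ (measurableTypeR R) N (fun n _ => n%:R)).
move=> _ B _; rewrite setTI.
have -> : N @^-1` B = \bigcup_(n in B) ((fun w => (N w)%:R : R) @^-1` [set n%:R]).
  apply/seteqP; split => [w Bw|w [n Bn /= /eqP]]; first by exists (N w).
  by rewrite eqr_nat => /eqP ->.
apply: bigcup_measurable => n _; rewrite -[X in measurable X]setTI.
exact: mN.
Qed.

Lemma markov_bound (P : probability T R) (M : T -> R) (E : set T) (y : R) :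
  measurable E -> measurable_fun setT M -> (forall w, 0 <= M w) -> 0 < y ->
  (forall w, E w -> y <= M w) -> (\int[P]_w (M w)%:E <= 1)%E ->
  (P E <= y^-1%:E)%E.
Proof.
move=> mE mM M0 y0 EM IM.
have : (y%:E * P E <= 1)%E.
  apply: le_trans IM; rewrite -[E]setIT -integral_indic// -ge0_integralZl//.
  - apply: ge0_le_integral => //=.
    + by move=> w _; rewrite mule_ge0 ?lee_fin ?(ltW y0).
    + by apply: emeasurable_funM => //; apply/measurable_EFinP; exact: measurable_indic.
    + exact/measurable_EFinP.
    + move=> w _; rewrite -EFinM lee_fin indicE; case: (boolP (_ \in _)) => //.
        by rewrite mulr1 inE; exact: EM.
      by rewrite mulr0.
  - by apply/measurable_EFinP; exact: measurable_indic.
  - by rewrite lee_fin ltW.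
by rewrite -lee_pdivlMl// mule1.
Qed.

(** The strict event is the increasing union of the events [Z <= s - 1/(j+1)], so continuity from
    below applies. It is meant for a supremum [s] that need not be attained. *)
Lemma probability_lt_le (P : probability T R) (E : set T) (Z : T -> R)
    (s : R) (b : \bar R) :
  measurable E -> measurable_fun setT Z ->
  (forall x, x < s -> (P (E `&` [set w | (Z w <= x)%R]) <= b)%E) ->
  (P (E `&` [set w | (Z w < s)%R]) <= b)%E.
Proof.
move=> mE mZ Hb.
pose A (j : nat) : set T := E `&` [set w | Z w <= s - j.+1%:R^-1].
have mA j : measurable (A j).
  apply: measurableI => //.
  have -> : [set w | Z w <= s - j.+1%:R^-1] = Z @^-1` `]-oo, s - j.+1%:R^-1].
    by apply/seteqP; split => w /=; rewrite in_itv.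
  by rewrite -[X in measurable X]setTI; exact: mZ.
have -> : E `&` [set w | Z w < s] = \bigcup_j A j.
  apply/seteqP; split => [w [Ew /= Zs]|w [j _ [Ew /= Zs]]]; last first.
    by split => //=; apply: le_lt_trans Zs _; rewrite ltrBlDr ltrDl invr_gt0.
  have [k /= Hk] := ltr_add_invr Zs.
  by exists k => //; split => //=; rewrite lerBrDr ltW.
have cvA : P (A j) @[j --> \oo] --> P (\bigcup_j A j).
  apply: nondecreasing_cvg_mu => //; first exact: bigcupT_measurable.
  move=> m n mn; apply/subsetPset; apply: setIS => w /= /le_trans; apply.
  by rewrite lerD2l lerN2 lef_pV2 ?posrE// ler_nat ltnS.
apply: (@cvge_to_le _ _ _ _ _ _ _ cvA).
by apply: nearW => j; apply: Hb; rewrite ltrBlDr ltrDl invr_gt0.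
Qed.

End measure_complements.

(** * From mutual independence to product formulas for integrals *)

Section independence.
Context {d : measure_display} {T : measurableType d} {R : realType}.
Context {I : eqType}.
Variables (P : probability T R) (Y : I -> T -> R).
Hypothesis mY : forall i, measurable_fun setT (Y i).
Hypothesis indY : mutually_independent P Y.

(** A pi-system generating the sigma-algebra of the variables indexed by [J]; the list is
    duplicate-free so that [mutually_independent] applies to it. *)
Definition cylinders (J : set I) : set (set T) :=
  [set E | exists L B, [/\ uniq L, (forall i, i \in L -> J i),
     (forall i, measurable (B i)) &
     E = \bigcap_(i in [set i | i \in L]) (Y i @^-1` B i)]].

(* The sample space with the sigma-algebra generated by the [Y i], [i] in [J]. *)
Definition from (J : set I) : Type := g_sigma_algebraType (cylinders J).
HB.instance Definition _ J := Measurable.on (from J).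

Lemma cylinders_setI J : setI_closed (cylinders J).
Proof.
move=> _ _ [L1 [B1 [_ LJ1 mB1 ->]]] [L2 [B2 [_ LJ2 mB2 ->]]].
exists (undup (L1 ++ L2)), (fun i => (if i \in L1 then B1 i else setT) `&`
   (if i \in L2 then B2 i else setT)); split.
- exact: undup_uniq.
- by move=> i; rewrite mem_undup mem_cat => /orP[/LJ1|/LJ2].
- by move=> i; apply: measurableI; case: ifP.
- apply/seteqP; split => [w [H1 H2] i /= _|w H].
    by split; case: ifP => // iL; [exact: H1|exact: H2].
  split => i /= iL; have /= := H i; rewrite mem_undup mem_cat iL ?orbT.
    by move=> /(_ isT)[].
  by move=> /(_ isT)[].
Qed.

Lemma cylinders_measurable J : cylinders J `<=` measurable.
Proof.
move=> _ [L [B [uL LJ mB ->]]].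
apply: fin_bigcap_measurable; first exact: finite_seq.
by move=> i _; rewrite -[X in measurable X]setTI; exact: mY.
Qed.

Lemma measurable_from J (E : set T) : measurable (E : set (from J)) -> measurable E.
Proof.
apply: smallest_sub; last exact: cylinders_measurable.
by split => [|A mA|A mA]; [exact: measurable0|rewrite setTD; exact: measurableC|
  exact: bigcupT_measurable].
Qed.

Lemma measurable_fun_from J {d'} {T' : measurableType d'} (f : T -> T') :
  measurable_fun setT (f : from J -> T') -> measurable_fun setT f.
Proof.
by move=> mf _ B mB; apply: (@measurable_from J); exact: mf.
Qed.

Lemma measurable_fun_from_sub J J' {d'} {T' : measurableType d'} (f : T -> T') :
  J `<=` J' -> measurable_fun setT (f : from J -> T') ->
  measurable_fun setT (f : from J' -> T').
Proof.
move=> JJ' mf _ B mB; have := mf measurableT B mB.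
apply: sub_smallest2r; first exact: smallest_sigma_algebra.
move=> A [L [C [uL LJ mC ->]]].
by exists L, C; split => // i /LJ /JJ'.
Qed.

Lemma measurable_from_Y J i : J i -> measurable_fun setT (Y i : from J -> R).
Proof.
move=> Ji _ B mB; rewrite setTI; apply: sub_sigma_algebra.
exists [:: i], (fun=> B); split => //.
  by move=> j; rewrite inE => /eqP ->.
apply/seteqP; split => [w Hw j|w /(_ i)]; first by rewrite /= inE => /eqP ->.
by apply; rewrite /= inE.
Qed.

(** Pi-lambda argument: the events satisfying the product formula form a lambda-system. On a
    cylinder, [i] is not among the constrained indices, so independence for the longer list [i :: L]
    gives the formula. *)
Lemma indep_event J i (E : set T) (B : set R) : ~ J i ->
  measurable (E : set (from J)) -> measurable B ->
  P (E `&` Y i @^-1` B) = (P E * P (Y i @^-1` B))%E.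
Proof.
move=> nJi mE mB; move: E mE.
have mYB : measurable (Y i @^-1` B).
  by rewrite -[X in measurable X]setTI; exact: mY.
pose H : set (set T) := [set E | measurable E /\
   P (E `&` Y i @^-1` B) = (P E * P (Y i @^-1` B))%E].
suff : <<s cylinders J >> `<=` H by move=> sH E /sH[].
apply: lambda_system_subset => //; first exact: cylinders_setI.
  apply/dynkin_lambda_system; split.
  - by split => //; rewrite setTI probability_setT mul1e.
  - move=> A [mA PA]; split; first exact: measurableC.
    rewrite -setTD setIDAC setTI.
    have -> : Y i @^-1` B `\` A = Y i @^-1` B `\` (A `&` Y i @^-1` B).
      by apply/seteqP; split => w /= [a b]; split => //; tauto.
    rewrite measureD//; last 2 first.
      by apply: measurableI.
      by rewrite ltey_eq fin_num_measure.
    rewrite setTD probability_setC// setICA setIid.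
    rewrite [X in (_ - X)%E](_ : _ = P A * P (Y i @^-1` B))%E//.
    rewrite muleBl ?mul1e ?fin_num_measure//.
  - move=> F tF HF; split; first by apply: bigcupT_measurable => n; have [] := HF n.
    rewrite setI_bigcupl.
    have tFB : trivIset setT (fun n => F n `&` Y i @^-1` B).
      by under eq_fun do rewrite setIC; exact: trivIset_setIl.
    rewrite measure_bigcup//; last by move=> n _; apply: measurableI => //; have [] := HF n.
    rewrite measure_bigcup//; last by move=> n _; have [] := HF n.
    have /fineK Pf : P (Y i @^-1` B) \is a fin_num by exact: fin_num_measure.
    rewrite muleC -Pf -nneseriesZl// Pf.
    by apply: eq_eseriesr => n _; rewrite [LHS](HF n).2 muleC.
move=> E CE; split; first exact: cylinders_measurable CE.
move: CE => [L [C [uL LJ mC ->]]].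
have iL : i \notin L by apply/negP => /LJ.
have := indY (i :: L) (fun j => if j == i then B else C j).
rewrite /= iL uL => /(_ isT).
have -> : \bigcap_(j in [set j | j \in i :: L])
    (Y j @^-1` (if j == i then B else C j)) =
    \bigcap_(j in [set j | j \in L]) (Y j @^-1` C j) `&` Y i @^-1` B.
  apply/seteqP; split => [w Hw|w [Hw Bw] j /=].
    split => [j jL|].
      have /= := Hw j; rewrite inE jL orbT => /(_ isT); case: eqP => // ji.
      by move: iL; rewrite -ji (_ : j \in L).
    by have /= := Hw i; rewrite inE eqxx => /(_ isT).
  by rewrite inE; case: eqP => [->//|_ /=]; exact: Hw.
move=> ->; last by move=> j; case: ifP.
rewrite big_cons eqxx muleC; congr (_ * _)%E.
rewrite indY//; apply: eq_big_seq => j jL; case: eqP => // ji.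
by move: iL; rewrite -ji jL.
Qed.

(** By [indep_event] and uniqueness of product measures, the joint law of the past and [Y i] is a
    product; Tonelli then separates the integrals. *)
Lemma indep_integral J i (f : T -> R) (h : R -> R) : ~ J i ->
  measurable_fun setT (f : from J -> R) -> (forall w, 0 <= f w) ->
  measurable_fun setT h -> (forall y, 0 <= h y) ->
  (\int[P]_w (f w * h (Y i w))%:E =
   \int[P]_w (f w)%:E * \int[P]_w (h (Y i w))%:E)%E.
Proof.
move=> nJi mf f0 mh h0.
(* The identity into the coarser sigma-algebra stands for all variables in [J] at once, so [f] need
   not be factored through them. *)
have mid : measurable_fun setT (id : T -> from J).
  by move=> _ B mB; rewrite setTI; exact: (@measurable_from J).
pose idm : {mfun T >-> from J} := HB.pack (id : T -> from J)
  (isMeasurableFun.Build _ _ _ _ _ mid).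
pose Ym : {mfun T >-> R} := HB.pack (Y i : T -> R)
  (isMeasurableFun.Build _ _ _ _ _ (mY i)).
have mpair : measurable_fun setT (fun w => (w, Y i w) : (from J * R)%type).
  by apply: measurable_fun_pair => //; exact: mY.
pose pairm : {mfun T >-> (from J * R)%type} :=
  HB.pack (fun w => (w, Y i w) : (from J * R)%type)
  (isMeasurableFun.Build _ _ _ _ _ mpair).
have mfE : measurable_fun setT (EFin \o f : from J -> \bar R) by exact/measurable_EFinP.
have mhE : measurable_fun setT (EFin \o h : R -> \bar R).
  exact/measurable_EFinP.
pose g (z : (from J * R)%type) : \bar R := ((f z.1)%:E * (h z.2)%:E)%E.
have mg : measurable_fun setT g.
  apply: emeasurable_funM.
    exact: (measurableT_comp mfE measurable_fst).
  exact: (measurableT_comp mhE measurable_snd).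
have g0 z : (0 <= g z)%E by rewrite mule_ge0 ?lee_fin.
transitivity (\int[distribution P pairm]_z g z)%E.
  by rewrite ge0_integral_distribution//; apply: eq_integral => w _; rewrite /g /= EFinM.
rewrite (eq_measure_integral (distribution P idm \x distribution P Ym)%E); last first.
  move=> A mA _; apply/esym; apply: product_measure_unique => //.
  move=> A1 B1 mA1 mB1; exact: (indep_event J i A1 B1 nJi mA1 mB1).
rewrite fubini_tonelli1//.
under eq_integral.
  move=> x _; rewrite /fubini_F /g /= ge0_integralZl//; last 2 first.
    by move=> y _; rewrite lee_fin.
    by rewrite lee_fin.
  over.
rewrite /= ge0_integralZr//; last 2 first.
  by move=> y _; rewrite lee_fin.
  by apply: integral_ge0 => y _; rewrite lee_fin.
by rewrite !ge0_integral_distribution//= => y; rewrite lee_fin.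
Qed.

End independence.

(** * Convexity of [F], the variational divergence and the index *)

Section exponential_family.
Context {R : realType}.
Variables (rho : {measure set R -> \bar R}) (Afun : R -> R)
  (th_lo th_hi : \bar R) (F : R -> R).
Hypothesis efA : exp_family_assumptions rho Afun th_lo th_hi F.

Local Notation Th := (Theta th_lo th_hi).
Local Notation dens := (ef_density Afun F).
Local Notation mean := (ef_mean rho Afun F).
Local Notation kl_d := (kl_d rho Afun th_lo th_hi F).
Local Notation index := (klucb4p_index rho Afun th_lo th_hi F).

Lemma ef_density_ge0 th x : 0 <= dens th x.
Proof. by have [_ _ A0 _] := efA; rewrite mulr_ge0 ?expR_ge0. Qed.

Lemma measurable_ef_density th : measurable_fun setT (dens th).
Proof.
have [_ mA _ _] := efA; apply: measurable_funM => //.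
apply: measurableT_comp => //; apply: measurable_funB => //.
exact: measurable_funM.
Qed.

Lemma ef_densityE th t x :
  dens t x = expR ((t - th) * x - (F t - F th)) * dens th x.
Proof.
rewrite /ef_density mulrCA -expRD; congr (_ * expR _); ring.
Qed.

Lemma integrable_ef_density th : Th th ->
  rho.-integrable setT (EFin \o dens th).
Proof.
move=> Tth; have [_ _ _ [I1 _ _ _]] := efA.
apply/integrableP; split; first by apply/measurable_EFinP; exact: measurable_ef_density.
rewrite (eq_integral (EFin \o dens th)) ?I1 ?ltry// => x _.
by rewrite /= ger0_norm// ef_density_ge0.
Qed.

(** With [y = (t - th) x - D], the density at [t] is [e^y] times the density at [th], so
    [1 + y <= e^y] integrates to [1 - D + (t - th) mean th <= 1]. *)
Lemma ef_subgradient th t : Th th -> Th t -> mean th * (t - th) <= F t - F th.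
Proof.
move=> Tth Tt; have [_ _ _ [I1 Im _ _]] := efA.
set D := F t - F th.
have dI := integrable_ef_density th Tth.
have mI := Im th Tth.
have E1 : (\int[rho]_x ((1 - D) * dens th x + (t - th) * (x * dens th x))%:E =
    ((1 - D) + (t - th) * mean th)%:E)%E.
  under eq_integral do rewrite EFinD (EFinM (1 - D)) (EFinM (t - th)).
  rewrite integralD//; try exact: integrableZl.
  rewrite integralZl// integralZl// I1// mule1 [RHS]EFinD [in RHS]EFinM.
  by rewrite /ef_mean fineK// integrable_fin_num.
have : ((1 - D + (t - th) * mean th)%:E <= 1)%E.
  rewrite -E1 -(I1 t Tt); apply: le_integral => //.
  - under eq_fun do rewrite EFinD (EFinM (1 - D)) (EFinM (t - th)).
    by apply: integrableD => //; exact: integrableZl.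
  - exact: integrable_ef_density.
  - move=> x _; rewrite lee_fin (ef_densityE th t).
    have := expR_ge1Dx ((t - th) * x - D).
    move/(ler_wpM2r (ef_density_ge0 th x)); apply: le_trans.
    rewrite le_eqVlt; apply/orP; left; apply/eqP; ring.
by rewrite lee_fin => H; lra.
Qed.

Lemma Theta_between a b t : Th a -> Th b -> a <= t <= b -> Th t.
Proof.
move=> [a1 _] [_ b2] /andP[at_ tb]; split.
  by rewrite (lt_le_trans a1)// lee_fin.
by rewrite (le_lt_trans _ b2)// lee_fin.
Qed.

Lemma Theta_nbhs th : Th th -> exists a b, [/\ a < th, th < b, Th a & Th b].
Proof.
move=> [h1 h2].
have [a [ath loa]] : exists a, a < th /\ (th_lo < a%:E)%E.
  case: th_lo h1 => [l| |] //=; last by exists (th - 1); split; [lra|exact: ltNyr].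
  by rewrite lte_fin => lth; exists ((l + th) / 2); rewrite lte_fin; split; lra.
have [b [thb bhi]] : exists b, th < b /\ (b%:E < th_hi)%E.
  case: th_hi h2 => [u| |] //=; last by exists (th + 1); split; [lra|exact: ltry].
  by rewrite lte_fin => thu; exists ((u + th) / 2); rewrite lte_fin; split; lra.
exists a, b; split => //; split => //.
  by rewrite (lt_trans _ h2)// lte_fin.
by rewrite (lt_trans h1)// lte_fin.
Qed.

Lemma ef_derivable th : Th th -> derivable F th 1.
Proof. by move=> Tth; have [_ _ _ [_ _ /(_ th Tth)[dF _ _] _]] := efA; exact: dF. Qed.

Lemma ef_derivable1 th : Th th -> derivable (derive1 F) th 1.
Proof. by move=> Tth; have [_ _ _ [_ _ /(_ th Tth)[_ dF _] _]] := efA; exact: dF. Qed.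

(** By the subgradient inequality, [F t - mean th * t] has a minimum at the interior point [th],
    where its derivative must vanish. No differentiation under the integral is involved. *)
Lemma ef_derive th : Th th -> derive1 F th = mean th.
Proof.
move=> Tth.
have [a [b [ath thb Ta Tb]]] := Theta_nbhs th Tth.
have abT t : t \in `]a, b[%R -> Th t.
  by rewrite in_itv /= => /andP[at_ tb]; apply: (Theta_between a b) => //; rewrite !ltW.
pose g := F - (fun t => mean th * t).
have dlin t : derivable (fun t => mean th * t) t 1 by apply: derivableM.
have : is_derive th 1 g 0.
  apply: (@derive1_at_min R g a b th).
  - by rewrite ltW// (lt_trans ath).
  - move=> t /abT Tt; apply: derivableB; last exact: dlin.
    exact: ef_derivable.
  - by rewrite in_itv /= ath.
  - move=> t /abT Tt; rewrite /g !fctE /=; have := ef_subgradient th t Tth Tt; lra.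
move=> /@derive_val.
rewrite /g deriveB; last 2 first.
  exact: ef_derivable.
  exact: dlin.
rewrite derive1E deriveM// derive_id derive_cst scaler0 addr0 => /eqP.
by rewrite subr_eq0 => /eqP ->; rewrite /GRing.scale /= mulr1.
Qed.

Lemma ef_mean_lt a b : Th a -> Th b -> (mean a < mean b) = (a < b).
Proof. by move=> Ta Tb; have [_ _ _ [_ _ _ h]] := efA; apply: h; rewrite inE. Qed.

Lemma ef_mean_invK th : Th th -> ef_mean_inv rho Afun th_lo th_hi F (mean th) = th.
Proof.
move=> Tth; rewrite /ef_mean_inv; case: xgetP => [t _ [Tt mt]|/(_ th)]; last first.
  by move=> H; exfalso; apply: H.
case: (ltgtP t th) => [lt_t|lt_t|//].
  by move: (lt_t); rewrite -ef_mean_lt// mt ltxx.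
by move: (lt_t); rewrite -ef_mean_lt// mt ltxx.
Qed.

Lemma kl_divE th t : Th th -> Th t ->
  kl_div rho Afun th_lo th_hi F (mean th) (mean t) =
  F t - F th - mean th * (t - th).
Proof. by move=> Tth Tt; rewrite /kl_div (ef_mean_invK th Tth) (ef_mean_invK t Tt) (ef_derive th Tth). Qed.

(** The two branches of [kl_d] agree: for [x = mean th], the subgradient inequality says that the
    supremum is attained at [s = th]. *)
Lemma kl_dE x t : Th t -> kl_d x (mean t) =
  (ereal_sup [set (x * s - F s)%:E | s in Th] - (x * t - F t)%:E)%E.
Proof.
move=> Tt; rewrite /Defs.kl_d; case: asboolP => [[th Tth <-]|_]; last first.
  by rewrite ef_mean_invK.
rewrite kl_divE//.
have -> : ereal_sup [set (mean th * s - F s)%:E | s in Th] =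
    (mean th * th - F th)%:E.
  apply/eqP; rewrite eq_le; apply/andP; split; last first.
    by apply: ereal_sup_ubound; exists th.
  apply: ge_ereal_sup => _ [s Ts <-]; rewrite lee_fin.
  have := ef_subgradient th s Tth Ts; lra.
by rewrite -EFinB; congr (_%:E); ring.
Qed.

Lemma kl_d_ge x s t : Th s -> Th t ->
  (((s - t) * x - (F s - F t))%:E <= kl_d x (mean t))%E.
Proof.
move=> Ts Tt; rewrite kl_dE// leeBrDr// -EFinD.
apply: ereal_sup_ubound; exists s => //; congr (_%:E); ring.
Qed.

(** The supremum may not be attained, but a near-maximiser suffices and provides an actual tilting
    parameter. *)
Lemma kl_d_gt x t l : Th t -> (l%:E < kl_d x (mean t))%E ->
  exists2 s, Th s & l < (s - t) * x - (F s - F t).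
Proof.
move=> Tt; rewrite kl_dE// lteBrDr// -EFinD => /ereal_sup_gt[_ [s Ts <-]].
by rewrite lte_fin => H; exists s => //; lra.
Qed.

(** Below [mean t], parameters [s > t] give negative values, while [s = t] gives 0. Only [s <= t]
    matter, and these give affine functions of [x] with nonpositive slope. *)
Lemma kl_d_antitone x x' t : Th t -> x <= x' -> x' < mean t ->
  (kl_d x' (mean t) <= kl_d x (mean t))%E.
Proof.
move=> Tt xx' x't; rewrite leNgt; apply/negP.
case: (kl_d x (mean t)) (kl_d_ge x t t Tt Tt) (fun s Ts => kl_d_ge x s t Ts Tt) => //=; last first.
  by move=> _ _; rewrite ltNge leey.
move=> l; rewrite lee_fin => l0 lge /(kl_d_gt _ _ _ Tt)[s Ts].
have := lge s Ts; rewrite lee_fin => ls lt_l.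
have := ef_subgradient t s Tt Ts => sub.
case: (leP s t) => st; first by nra.
by nra.
Qed.

(** A candidate [q] for [m] either lies below [m'], hence below the index of [m'], or stays
    admissible because the divergence decreases as the empirical mean moves up towards [q]. *)
Lemma index_nondecreasing c n t : {homo (fun m => index c n m t) : x y / x <= y >-> (x <= y)%E}.
Proof.
move=> m m' mm'; apply: ge_ereal_sup => _ [->|[q [[th Tth <-] [mq le_q]] <-]].
  apply: (@le_trans _ _ m'%:E); first by rewrite lee_fin.
  by apply: ereal_sup_ubound; left.
case: (leP (mean th) m') => m'q.
  apply: (@le_trans _ _ m'%:E); first by rewrite lee_fin.
  by apply: ereal_sup_ubound; left.
apply: ereal_sup_ubound; right; exists (mean th) => //; split; first by exists th.
split => //; apply: le_trans le_q; apply: lee_wpmul2l; first by rewrite lee_fin.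
exact: kl_d_antitone.
Qed.

(** Monotonicity of the index makes the indicator a nondecreasing real function, hence
    measurable. *)
Lemma measurable_index_ge c n t (tau : R) :
  measurable_fun setT (fun m => (tau%:E <= index c n m t)%E).
Proof.
have /measurable_fun_natr : measurable_fun setT
    (fun m => (nat_of_bool (tau%:E <= index c n m t)%E)%:R : R).
  apply: nondecreasing_measurable => // x y xy.
  rewrite ler_nat; case: (boolP (_ <= index c n x t)%E) => // xi.
  by rewrite (le_trans xi)//; exact: index_nondecreasing.
move=> mi; apply: (@measurable_fun_bool _ _ _ _ true).
have := mi measurableT [set 1%N] I; rewrite !setTI.
by congr measurable; apply/seteqP; split => m /=; case: (_ <= _)%E.
Qed.

(** An index below [tau < mean th] means that [m < mean th] and that [mean th] itself is
    inadmissible, so [n d(m, mean th) > L]. A near-maximising [s >= th] would give a nonpositive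
    deviation, contradicting [0 <= L]. *)
Lemma index_lt_deviation c n m t (tau th : R) (L := ln t%:R + c * ln (ln t%:R)) :
  Th th -> tau < mean th -> 0 <= L -> (0 < n)%N ->
  ~~ (tau%:E <= index c n m t)%E ->
  exists s, [/\ Th s, s < th & L < n%:R * ((s - th) * m - (F s - F th))].
Proof.
move=> Tth taum L0 n0; rewrite -ltNge => idx.
have mth : m < mean th.
  rewrite ltNge; apply/negP => thm; move: idx; rewrite ltNge => /negP; apply.
  apply: (@le_trans _ _ m%:E); first by rewrite lee_fin (le_trans (ltW taum)).
  by apply: ereal_sup_ubound; left.
have nR : 0 < n%:R :> R by rewrite ltr0n.
have : (L%:E < n%:R%:E * kl_d m (mean th))%E.
  rewrite ltNge; apply/negP => kL; move: idx; rewrite ltNge => /negP; apply.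
  apply: (@le_trans _ _ (mean th)%:E); first by rewrite lee_fin ltW.
  apply: ereal_sup_ubound; right; exists (mean th) => //; split => //.
  by exists th.
rewrite -lte_pdivrMl// -EFinM => /(kl_d_gt _ _ _ Tth)[s Ts Ls].
exists s; split => //; last by rewrite -ltr_pdivrMl.
have sub := ef_subgradient th s Tth Ts.
have L0' : 0 <= n%:R^-1 * L by rewrite mulr_ge0// invr_ge0 ltW.
rewrite ltNge; apply/negP => ths.
have : 0 <= (mean th - m) * (s - th) by rewrite mulr_ge0// subr_ge0// ltW.
by move: sub L0' Ls; clear; lra.
Qed.

(** Subgradients at [th] and at the midpoint bound the two halves of the increment of [F]; strict
    growth of the mean makes the second bound strict. *)
Lemma kl_div_gt0 th t : Th th -> Th t -> th < t ->
  0 < kl_div rho Afun th_lo th_hi F (mean th) (mean t).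
Proof.
move=> Tth Tt tht; rewrite kl_divE//.
pose s := (th + t) / 2; have Ts : Th s.
  by apply: (Theta_between th t) => //; apply/andP; rewrite /s; split; lra.
have ths : th < s by rewrite /s; lra.
have st : s < t by rewrite /s; lra.
have := ef_subgradient th s Tth Ts; have := ef_subgradient s t Ts Tt.
have : mean th < mean s by rewrite ef_mean_lt.
by nra.
Qed.

Lemma ef_continuous th : Th th -> {for th, continuous F}.
Proof.
move=> Tth; apply: differentiable_continuous; apply/derivable1_diffP.
exact: ef_derivable.
Qed.

Lemma ef_derive_continuous th : Th th -> {for th, continuous (derive1 F)}.
Proof.
move=> Tth; apply: differentiable_continuous; apply/derivable1_diffP.
exact: ef_derivable1.
Qed.

Lemma near_left_gt (g : R -> R) (a b y : R) : {for b, continuous g} ->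
  a < b -> y < g b -> exists x, [/\ a < x, x < b & y < g x].
Proof.
move=> cg ab gy; have := cvgr_gt _ cg y.
move=> /(_ _ gy) /nbhs_ballP[e /= e0 He].
pose e' := Num.min (e / 2) ((b - a) / 2).
have e'0 : 0 < e' by rewrite lt_min; apply/andP; split; lra.
have e'e : e' <= e / 2 by rewrite ge_min lexx.
have e't : e' <= (b - a) / 2 by rewrite ge_min lexx orbT.
exists (b - e'); split; [lra|lra|apply: He].
by rewrite /ball /= opprB addrC subrK gtr0_norm//; lra.
Qed.

Lemma near_right_lt (g : R -> R) (a b y : R) : {for a, continuous g} ->
  a < b -> g a < y -> exists x, [/\ a < x, x < b & g x < y].
Proof.
move=> cg ab gy; have := cvgr_lt _ cg y.
move=> /(_ _ gy) /nbhs_ballP[e /= e0 He].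
pose e' := Num.min (e / 2) ((b - a) / 2).
have e'0 : 0 < e' by rewrite lt_min; apply/andP; split; lra.
have e'e : e' <= e / 2 by rewrite ge_min lexx.
have e't : e' <= (b - a) / 2 by rewrite ge_min lexx orbT.
exists (a + e'); split; [lra|lra|apply: He].
by rewrite /ball /= opprD addrA subrr sub0r normrN gtr0_norm//; lra.
Qed.

Lemma kl_div_left th t0 y : Th th -> Th t0 -> th < t0 ->
  y < kl_div rho Afun th_lo th_hi F (mean th) (mean t0) ->
  exists t1, [/\ th < t1, t1 < t0 & y < F t1 - F th - mean th * (t1 - th)].
Proof.
move=> Tth Tt0 tht0; rewrite kl_divE// => yD.
pose g s := F s - F th - mean th * (s - th).
apply: (near_left_gt g) => //.
apply: cvgB.
  apply: cvgB; last exact: cvg_cst.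
  exact: ef_continuous.
by apply: cvgMr; apply: cvgB; [exact: cvg_id|exact: cvg_cst].
Qed.

(** Positivity of the Chernoff exponent: by continuity of F', some [x > th] has [mean x < r], and
    the subgradient at [x] bounds [F x - F th] by [mean x * (x - th)]. The tilt is [x - th]. *)
Lemma ef_cramer th t0 r : Th th -> Th t0 -> th < t0 -> mean th < r ->
  exists lam, [/\ 0 < lam, Th (th + lam) & F (th + lam) - F th < lam * r].
Proof.
move=> Tth Tt0 tht0 rm.
have [x [thx xt0]] : exists x, [/\ th < x, x < t0 & derive1 F x < r].
  apply: near_right_lt => //; last by rewrite ef_derive.
  exact: ef_derive_continuous.
have Tx : Th x by apply: (Theta_between th t0) => //; apply/andP; split; exact: ltW.
rewrite ef_derive// => mx.
exists (x - th); rewrite subr_gt0 thx addrC subrK; split => //.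
have := ef_subgradient x th Tx Tth; clear -mx thx => H.
have : mean x * (x - th) < r * (x - th) by rewrite ltr_pM2r// subr_gt0.
lra.
Qed.

(** The slack [1 + eps] leaves room for a level [r] above the true mean, independent of [n], [m] and
    [t]: were the empirical mean below [r], any candidate reaching [mean t0] would have too large a
    divergence after this many observations. *)
Lemma index_ge_deviation th t0 c eps :
  Th th -> Th t0 -> th < t0 -> 0 < eps ->
  exists r lam kap, [/\ 0 < lam, 0 < kap, Th (th + lam),
    kap <= lam * r - (F (th + lam) - F th) &
    forall n m t, (0 < n)%N -> ((mean t0)%:E <= index c n m t)%E ->
    ln t%:R + c * ln (ln t%:R) <
      n%:R * (kl_div rho Afun th_lo th_hi F (mean th) (mean t0) / (1 + eps)) ->
    r <= m].
Proof.
move=> Tth Tt0 tht0 eps0.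
have D0 := kl_div_gt0 th t0 Tth Tt0 tht0.
have DD := kl_div_left th t0 _ Tth Tt0 tht0 (_ : _ / (1 + eps) < _).
move: D0 DD; set D := kl_div _ _ _ _ _ _ _ => D0 DD.
have [|t1 [tht1 t1t0 gt1]] := DD D; first by rewrite ltr_pdivrMr; nra.
have Tt1 : Th t1 by apply: (Theta_between th t0) => //; apply/andP; split; exact: ltW.
(* [t1] lies strictly left of [t0] but its divergence still exceeds [D / (1 + eps)], by [G]. The
   minimum defining [r] keeps [r] below [mean t1] and the cost of replacing [mean th] by [r] below
   [G]. *)
pose G := F t1 - F th - mean th * (t1 - th) - D / (1 + eps).
have G0 : 0 < G by rewrite subr_gt0.
have mt1 : mean th < mean t1 by rewrite ef_mean_lt.
pose r := mean th + Num.min (mean t1 - mean th) (G / (t1 - th)).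
have rm : mean th < r.
  by rewrite ltrDl lt_min subr_gt0 mt1 divr_gt0// subr_gt0.
have rm1 : r <= mean t1 by rewrite /r -lerBrDl ge_min lexx.
have rG : (r - mean th) * (t1 - th) <= G.
  by rewrite -ler_pdivlMr ?subr_gt0// /r addrC addKr ge_min lexx orbT.
have [lam [lam0 Tlam Flam]] := ef_cramer th t0 r Tth Tt0 tht0 rm.
exists r, lam, (lam * r - (F (th + lam) - F th)); split => //.
  by rewrite subr_gt0.
move=> n m t n0 idx Ln; rewrite leNgt; apply/negP => mr.
have nR : 0 < n%:R :> R by rewrite ltr0n.
have : ((mean t1)%:E < index c n m t)%E.
  by apply: lt_le_trans idx; rewrite lte_fin ef_mean_lt.
move=> /ereal_sup_gt[_ [->|[_ [[s Ts <-] [mq le_q]] <-]]]; rewrite lte_fin.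
  by rewrite ltNge (le_trans (ltW mr)).
rewrite ef_mean_lt// => t1s.
have nk : (0 <= n%:R%:E :> \bar R)%E by rewrite lee_fin ltW.
(* Testing the supremum at [th] gives [F s - F th - (s - th) m]. For [m < r] and [s > t1], the
   subgradient at [t1] bounds this below by [D / (1 + eps)]. *)
have := le_trans (lee_wpmul2l nk (kl_d_ge m th s Tth Ts)) le_q.
rewrite -EFinM lee_fin; apply/negP; rewrite -ltNge; apply: (lt_le_trans Ln).
rewrite ler_pM2l//.
have sub := ef_subgradient t1 s Tt1 Ts.
have : 0 <= (r - m) * (s - th) by rewrite mulr_ge0// subr_ge0 ltW// (lt_trans tht1).
have : 0 <= (mean t1 - r) * (s - t1) by rewrite mulr_ge0 ?subr_ge0// ltW.
by move: rG sub; rewrite /G; clear; lra.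
Qed.

(** The integrand is the likelihood ratio of [s] to [th], so its expectation under [th] is the total
    mass of the density at [s]. *)
Lemma ef_mgf {d} {T : measurableType d} (P : probability T R) (X : T -> R) th s :
  Th th -> Th s -> measurable_fun setT X ->
  (forall B, measurable B -> P (X @^-1` B) = ef_law rho Afun F th B) ->
  (\int[P]_w (expR ((s - th) * X w - (F s - F th)))%:E = 1)%E.
Proof.
move=> Tth Ts mX PX; have [_ _ _ [I1 _ _ _]] := efA.
pose Xm : {mfun T >-> R} := HB.pack X (isMeasurableFun.Build _ _ _ _ _ mX).
pose g (x : R) : \bar R := (expR ((s - th) * x - (F s - F th)))%:E.
have mg : measurable_fun setT g.
  apply/measurable_EFinP; apply: measurableT_comp => //.
  by apply: measurable_funB => //; exact: measurable_funM.
have g0 x : (0 <= g x)%E by rewrite lee_fin expR_ge0.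
have := @ge0_integral_distribution _ _ _ _ _ P Xm g mg g0 => /= <-.
rewrite (@ge0_integral_density _ _ _ rho _ (dens th) g)//.
- rewrite -[RHS](I1 s Ts); apply: eq_integral => x _.
  by rewrite (ef_densityE th s) EFinM.
- exact: measurable_ef_density.
- exact: ef_density_ge0.
Qed.

End exponential_family.

(** * The process of one arm: measurability, counts and predictability *)

Definition arm_var {T : Type} {R : realType} (C : nat -> T -> nat)
    (X : nat -> nat -> T -> R) (i : nat + nat * nat) : T -> R :=
  match i with
  | inl t => if (1 <= t)%N then fun w => (C t w)%:R else fun=> 0
  | inr kt => if (1 <= kt.1)%N && (1 <= kt.2)%N then X kt.1 kt.2 else fun=> 0
  end.

Section arm_process.
Context {d : measure_display} {T : measurableType d} {R : realType}.
Variables (P : probability T R) (u : nat -> R -> nat -> \bar R) (tau : R).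
Variables (cm cp : nat) (C : nat -> T -> nat) (X : nat -> nat -> T -> R).
Hypothesis C_bounds : forall t w, (1 <= t)%N -> (cm <= C t w <= cp)%N.
Hypothesis mC : forall t, measurable_fun setT (fun w => (C t w)%:R : R).
Hypothesis mX : forall k t, measurable_fun setT (X k t).
Hypothesis indCX : mutually_independent P (arm_var C X).
Hypothesis mu_ge : forall n t, measurable_fun setT (fun m => (tau%:E <= u n m t)%E).

Let stats t w := arm_stats u tau (fun s => C s w) (fun k s => X k s w) t.
Let N t w := (stats t w).1.
Let S t w := (stats t w).2.
Let A t w := in_A u tau (fun s => C s w) (fun k s => X k s w) t.

(* [A t.+1] and the statistics after round [t] depend on the variables of
   rounds [1 .. t] only; [round t n] adds the number of clients of round [t.+1]
   and their first [n] rewards. *)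
Definition past (t : nat) : set (nat + nat * nat) :=
  [set i | match i with inl s => (s <= t)%N | inr ks => (ks.2 <= t)%N end].
Definition round (t n : nat) : set (nat + nat * nat) :=
  [set i | match i with
           | inl s => (s <= t.+1)%N
           | inr ks => (ks.2 <= t)%N || (ks.2 == t.+1) && (ks.1 <= n)%N
           end].

Local Notation from := (from (arm_var C X)).

Lemma measurable_arm_var i : measurable_fun setT (arm_var C X i).
Proof. by case: i => [t|[k t]] /=; case: ifP. Qed.

Lemma past_round t n : past t `<=` round t n.
Proof. by move=> [s|[k s]] /=; [exact: leqW|move=> ->]. Qed.

Lemma round_subset t n n' : (n <= n')%N -> round t n `<=` round t n'.
Proof.
move=> nn' [s|[k s]] //= /orP[->//|/andP[-> /leq_trans]] /(_ _ nn') ->.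
by rewrite orbT.
Qed.

Lemma round_past t n : round t n `<=` past t.+1.
Proof.
by move=> [s|[k s]] //= /orP[|/andP[/eqP ->]] //; exact: leqW.
Qed.

Lemma measurable_clients J t : J (inl t.+1) ->
  measurable_fun setT (C t.+1 : from J -> nat).
Proof.
by move=> Jt; apply/(@measurable_fun_natr _ _ R); exact: (measurable_from_Y _ J (inl t.+1)).
Qed.

Lemma measurable_reward J k t : J (inr (k.+1, t.+1)) ->
  measurable_fun setT (X k.+1 t.+1 : from J -> R).
Proof. by move=> Jt; exact: (measurable_from_Y _ J (inr (k.+1, t.+1))). Qed.

Lemma measurable_in_A t :
  measurable_fun setT (N t : from (past t) -> nat) ->
  measurable_fun setT (S t : from (past t) -> R) ->
  measurable_fun setT (A t.+1 : from (past t) -> bool).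
Proof.
case: t => [|t] mN mS; first exact: measurable_cst.
rewrite /A /in_A /in_next /=.
apply: (@measurable_fun_nat_case _ (from (past t.+1)) _ _ (N t.+1)
  (fun n w => (tau%:E <= u n (S t.+1 w / n%:R) t.+1)%E)) => // n.
apply: (measurableT_comp (mu_ge n t.+1)).
by apply: measurable_funM.
Qed.

Lemma arm_N_rec t w :
  N t.+1 w = (if A t.+1 w then N t w + C t.+1 w else N t w)%N.
Proof. by rewrite /N /A /in_A /stats /=; case: ifP. Qed.

Lemma arm_S_rec t w :
  S t.+1 w = if A t.+1 w then S t w + \sum_(k < C t.+1 w) X k.+1 t.+1 w else S t w.
Proof. by rewrite /S /A /in_A /stats /=; case: ifP. Qed.

Lemma measurable_stats t :
  measurable_fun setT (N t : from (past t) -> nat) /\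
  measurable_fun setT (S t : from (past t) -> R).
Proof.
elim: t => [|t [mN mS]]; first by split; exact: measurable_cst.
have pp : past t `<=` past t.+1.
  by apply: subset_trans (round_past t 0); exact: past_round.
have mA := measurable_in_A t mN mS.
have {}mA := measurable_fun_from_sub _ _ _ _ pp mA.
have mN' := measurable_fun_from_sub _ _ _ _ pp mN.
have mS' := measurable_fun_from_sub _ _ _ _ pp mS.
have mCt : measurable_fun setT (C t.+1 : from (past t.+1) -> nat).
  by apply: measurable_clients; exact: leqnn.
split.
- have -> : N t.+1 = (fun w => if A t.+1 w then (N t w + C t.+1 w)%N else N t w).
    by apply/funext => w; exact: arm_N_rec.
  apply: measurable_fun_ifT => //.
  apply: (@measurable_fun_nat_case _ (from (past t.+1)) _ _ (N t)
    (fun n w => (n + C t.+1 w)%N)) => // n.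
  apply: (@measurable_fun_nat_case _ (from (past t.+1)) _ _ (C t.+1)
    (fun m w => (n + m)%N)) => // m.
- have -> : S t.+1 = (fun w => if A t.+1 w
      then S t w + \sum_(k < C t.+1 w) X k.+1 t.+1 w else S t w).
    by apply/funext => w; exact: arm_S_rec.
  apply: measurable_fun_ifT => //; apply: measurable_funD => //.
  apply: (@measurable_fun_nat_case _ (from (past t.+1)) _ _ (C t.+1)
    (fun m w => \sum_(k < m) X k.+1 t.+1 w)) => // m.
  apply: measurable_sum => k; apply: measurable_reward.
  exact: leqnn.
Qed.

Lemma measurable_A t : measurable_fun setT (A t.+1 : from (past t) -> bool).
Proof. by have [mN mS] := measurable_stats t; exact: measurable_in_A. Qed.

Definition pulls t w : nat := \sum_(s < t) A s.+1 w.

Lemma pulls_rec t w : pulls t.+1 w = (pulls t w + A t.+1 w)%N.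
Proof. by rewrite /pulls big_ord_recr. Qed.

Lemma measurable_pulls t : measurable_fun setT (pulls t : from (past t) -> nat).
Proof.
elim: t => [|t mp].
  have -> : pulls 0 = cst 0%N by apply/funext => w; rewrite /pulls big_ord0.
  exact: measurable_cst.
have pp : past t `<=` past t.+1.
  by apply: subset_trans (round_past t 0); exact: past_round.
have mA := measurable_fun_from_sub _ _ _ _ pp (measurable_A t).
have {}mp := measurable_fun_from_sub _ _ _ _ pp mp.
have -> : pulls t.+1 = (fun w => if A t.+1 w then (pulls t w).+1 else pulls t w).
  by apply/funext => w; rewrite pulls_rec; case: (A t.+1 w); rewrite ?addn1 ?addn0.
apply: measurable_fun_ifT => //.
by apply: (@measurable_fun_nat_case _ (from (past t.+1)) _ _ (pulls t) (fun n w => n.+1)).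
Qed.

Lemma pulls_le t w : (pulls t w * cm <= N t w)%N.
Proof.
elim: t => [|t IH]; first by rewrite /pulls big_ord0.
rewrite pulls_rec arm_N_rec; case: (A t.+1 w); rewrite ?addn0//.
by rewrite mulnDl leq_add// mul1n; have /andP[] := C_bounds t.+1 w isT.
Qed.

Lemma arm_N_le t w : (N t w <= t * cp)%N.
Proof.
elim: t => [//|t IH]; rewrite arm_N_rec mulSnr.
have /andP[_ Ct] := C_bounds t.+1 w isT.
by case: (A t.+1 w); [exact: leq_add|exact: leq_trans IH (leq_addr _ _)].
Qed.

Lemma pulls_gt0 t w : (0 < pulls t.+1 w)%N.
Proof. by rewrite /pulls big_ord_recl. Qed.

Lemma arm_N_sum t w : N t w = (\sum_(s < t) A s.+1 w * C s.+1 w)%N.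
Proof.
elim: t => [|t IH]; first by rewrite big_ord0.
rewrite big_ord_recr -IH arm_N_rec /=; case: (A t.+1 w); rewrite ?mul1n//.
by rewrite mul0n addn0.
Qed.

Lemma measurable_natr {d'} {T' : measurableType d'} (f : T' -> nat) :
  measurable_fun setT f -> measurable_fun setT (fun w => (f w)%:R : R).
Proof. by move=> mf; exact/measurable_fun_natr. Qed.

Lemma measurable_boolr {d'} {T' : measurableType d'} (f : T' -> bool) :
  measurable_fun setT f -> measurable_fun setT (fun w => (f w)%:R : R).
Proof.
move=> mf.
have -> : (fun w => (f w)%:R) = (fun w => if f w then 1 else 0 : R).
  by apply/funext => w; case: (f w).
by apply: measurable_fun_ifT.
Qed.

Lemma indep_clients t (f : T -> R) (ct : R) :
  measurable_fun setT (f : from (past t) -> R) -> (forall w, 0 <= f w) ->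
  (\int[P]_w (C t.+1 w)%:R%:E <= ct%:E)%E ->
  (\int[P]_w (f w * (C t.+1 w)%:R)%:E <= ct%:E * \int[P]_w (f w)%:E)%E.
Proof.
move=> mf f0 Cct.
have ni : ~ past t (inl t.+1) by rewrite /past /= ltnn.
(* The absolute value replaces the identity, since [indep_integral] takes a function that is
   nonnegative on the whole line. *)
have := indep_integral P (arm_var C X) measurable_arm_var indCX (past t) (inl t.+1)
  f (fun x => `|x|) ni mf f0 (@normr_measurable R setT) (fun y => normr_ge0 y).
rewrite /=; under [X in _ = (_ * X)%E -> _]eq_integral do rewrite ger0_norm//.
under [X in X = _ -> _]eq_integral do rewrite ger0_norm//.
move=> ->; rewrite muleC; apply: lee_wpmul2r => //.
by apply: integral_ge0 => w _; rewrite lee_fin.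
Qed.

(** * The exponential martingale and the expected number of pulls *)

Section tilting.
Variables (lam phi : R).
Hypothesis mgfX : forall k t,
  (\int[P]_w (expR (lam * X k.+1 t.+1 w - phi))%:E = 1)%E.

(** The likelihood ratio of the first [n] rewards of round [t.+1], [phi] playing the role of their
    log moment generating function at [lam]. *)
Let E n t w : R := expR (lam * (\sum_(k < n) X k.+1 t.+1 w) - n%:R * phi).

Lemma measurable_tilt t n J : (forall k, (k < n)%N -> J (inr (k.+1, t.+1))) ->
  measurable_fun setT (E n t : from J -> R).
Proof.
move=> Jn; apply: measurableT_comp => //; apply: measurable_funB => //.
apply: measurable_funM => //; apply: measurable_sum => k.
by apply: measurable_reward; exact: Jn.
Qed.

Lemma measurable_tilt_total n t : measurable_fun setT (E n t).
Proof.
apply: measurableT_comp => //; apply: measurable_funB => //.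
by apply: measurable_funM => //; apply: measurable_sum.
Qed.

(** Rewards are peeled off one at a time: reward [n.+1] is independent of [round t n] and
    contributes a factor of mean 1. The weight [g] may depend on the number of clients of round
    [t.+1], but on none of its rewards. *)
Lemma tilt_rewards t n (g : T -> R) :
  measurable_fun setT (g : from (round t 0) -> R) -> (forall w, 0 <= g w) ->
  (\int[P]_w (g w * E n t w)%:E = \int[P]_w (g w)%:E)%E.
Proof.
move=> mg g0; elim: n => [|n IH].
  apply: eq_integral => w _; congr (_%:E).
  by rewrite /E big_ord0 mulr0 mul0r subrr expR0 mulr1.
rewrite -IH.
have ni : ~ round t n (inr (n.+1, t.+1)).
  by rewrite /round /= ltnn eqxx ltnn.
have mgE : measurable_fun setT ((fun w => g w * E n t w) : from (round t n) -> R).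
  apply: measurable_funM.
    by apply: measurable_fun_from_sub mg; exact: round_subset.
  by apply: measurable_tilt => k kn; rewrite /round /= eqxx kn orbT.
have mh : measurable_fun setT (fun x : R => expR (lam * x - phi)).
  by apply: measurableT_comp => //; apply: measurable_funB => //.
have := indep_integral P (arm_var C X) measurable_arm_var indCX (round t n)
  (inr (n.+1, t.+1)) _ (fun x => expR (lam * x - phi)) ni mgE
  (fun w => mulr_ge0 (g0 w) (expR_ge0 _)) mh (fun y => expR_ge0 _).
rewrite /= mgfX mule1 => <-; apply: eq_integral => w _; congr (_%:E).
rewrite /E big_ord_recr /= -mulrA; congr (_ * _); rewrite -expRD; congr expR.
by rewrite -natr1; ring.
Qed.

(** The number of factors is random but at most [cp]. Splitting over its values puts the indicator
    of [C t.+1 = n] into the weight of [tilt_rewards]. *)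
Lemma tilt_round t (f : T -> R) :
  measurable_fun setT (f : from (past t) -> R) -> (forall w, 0 <= f w) ->
  (\int[P]_w (f w * E (C t.+1 w) t w)%:E = \int[P]_w (f w)%:E)%E.
Proof.
move=> mf f0.
have mf0 : measurable_fun setT (f : from (round t 0) -> R).
  by apply: measurable_fun_from_sub mf; exact: past_round.
have mC0 : measurable_fun setT (C t.+1 : from (round t 0) -> nat).
  by apply: measurable_clients; exact: leqnn.
pose g n w : R := f w * (C t.+1 w == n)%:R.
have mg n : measurable_fun setT (g n : from (round t 0) -> R).
  apply: measurable_funM => //.
  exact: (@measurable_fun_nat_case _ (from (round t 0)) _ R (C t.+1) (fun m _ => (m == n)%:R)).
have g0 n w : 0 <= g n w by rewrite mulr_ge0.
have mE n := measurable_tilt_total n t.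
have decomp (h : nat -> T -> R) w :
    f w * h (C t.+1 w) w = \sum_(n < cp.+1) g n w * h n w.
  have /andP[_ Ct] := C_bounds t.+1 w isT.
  rewrite (bigD1 (Ordinal (Ct : (C t.+1 w < cp.+1)%N)))//= /g eqxx mulr1 big1 ?addr0//.
  move=> n ne; case: eqP => [En|]; last by rewrite mulr0 mul0r.
  by move: ne; rewrite -val_eqE /= En eqxx.
have mgT n : measurable_fun setT (g n).
  by apply: measurable_fun_from (mg n); exact: measurable_arm_var.
transitivity (\sum_(n < cp.+1) \int[P]_w (g n w * E n t w)%:E)%E.
  rewrite -ge0_integral_sum//.
  - by apply: eq_integral => w _; rewrite sumEFin (decomp (fun n w => E n t w)).
  - by move=> n; apply/measurable_EFinP; exact: measurable_funM.
  - by move=> n w _; rewrite lee_fin mulr_ge0// expR_ge0.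
under eq_bigr do rewrite tilt_rewards//.
rewrite -ge0_integral_sum//.
- apply: eq_integral => w _; rewrite sumEFin; congr (_%:E).
  have := decomp (fun _ _ => 1) w; rewrite mulr1 => ->.
  by apply: eq_bigr => n _; rewrite mulr1.
- by move=> n; exact/measurable_EFinP.
- by move=> n w _; rewrite lee_fin.
Qed.

Lemma measurable_tilt_stats (psi : R) t :
  measurable_fun setT ((fun w => expR (lam * S t w - (N t w)%:R * psi)) : from (past t) -> R).
Proof.
have [mN mS] := measurable_stats t.
apply: measurableT_comp => //; apply: measurable_funB; apply: measurable_funM => //.
exact: measurable_natr.
Qed.

(** On the predictable event that the arm is pulled, the process is multiplied by a factor averaging
    to 1 ([f1]); otherwise it does not change ([f2]). *)
Lemma tilt_stats t :
  (\int[P]_w (expR (lam * S t w - (N t w)%:R * phi))%:E = 1)%E.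
Proof.
elim: t => [|t IH].
  rewrite (eq_integral (cst 1%:E)) => [|w _]; last first.
    by rewrite /S /N /= mulr0 mul0r subrr expR0.
  by rewrite integral_cst// mul1e; exact: probability_setT.
rewrite -[RHS]IH.
pose M w := expR (lam * S t w - (N t w)%:R * phi).
have M0 w : 0 <= M w by exact: expR_ge0.
have mM : measurable_fun setT (M : from (past t) -> R) by exact: measurable_tilt_stats.
have mA := measurable_A t.
pose f1 w := M w * (A t.+1 w)%:R.
pose f2 w := M w * (~~ A t.+1 w)%:R.
have mf1 : measurable_fun setT (f1 : from (past t) -> R).
  by apply: measurable_funM => //; exact: measurable_boolr.
have mf2 : measurable_fun setT (f2 : from (past t) -> R).
  apply: measurable_funM => //; apply: measurable_boolr.
  exact: (measurableT_comp (f := negb)).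
have mf1T := measurable_fun_from _ measurable_arm_var _ _ mf1.
have mf2T := measurable_fun_from _ measurable_arm_var _ _ mf2.
have f10 w : 0 <= f1 w by rewrite mulr_ge0.
have f20 w : 0 <= f2 w by rewrite mulr_ge0.
have mE : measurable_fun setT (fun w => E (C t.+1 w) t w).
  apply: (@measurable_fun_nat_case _ _ _ _ (C t.+1) (fun n w => E n t w)).
    exact/(@measurable_fun_natr _ _ R).
  by move=> n; exact: measurable_tilt_total.
transitivity (\int[P]_w ((f1 w * E (C t.+1 w) t w)%:E + (f2 w)%:E))%E.
  apply: eq_integral => w _; rewrite -EFinD; congr (_%:E).
  rewrite arm_S_rec arm_N_rec /f1 /f2 /M; case: (A t.+1 w) => /=.
    rewrite mulr1 mulr0 addr0 /E -expRD; congr expR.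
    by rewrite natrD; ring.
  by rewrite mulr0 mul0r add0r mulr1.
rewrite ge0_integralD//; last 4 first.
- by move=> w _; rewrite lee_fin mulr_ge0// expR_ge0.
- by apply/measurable_EFinP; exact: measurable_funM.
- by move=> w _; rewrite lee_fin.
- exact/measurable_EFinP.
rewrite tilt_round// -ge0_integralD//; last 4 first.
- by move=> w _; rewrite lee_fin.
- exact/measurable_EFinP.
- by move=> w _; rewrite lee_fin.
- exact/measurable_EFinP.
apply: eq_integral => w _; rewrite -EFinD; congr (_%:E).
by rewrite /f1 /f2 -mulrDr; case: (A t.+1 w); rewrite /= ?addr0 ?add0r mulr1.
Qed.

(* While fewer than [m] pulls have been made, a pull multiplies [V] by at most 1
   in expectation, and by at most [q] afterwards. Since [V >= 1] at every
   late pull, the expected number of late pulls is at most [V 0 / (1 - q)]. *)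
Section potential.
Variables (kap : R) (m : nat).
Hypothesis kap_gt0 : 0 < kap.
Hypothesis cm_gt0 : (0 < cm)%N.

Let q : R := expR (- (cm%:R * kap)).
Let W t w : R := expR (lam * S t w - (N t w)%:R * (phi + kap)).
Let V t w : R := W t w * q ^+ (m - pulls t w).

(** A pull brings at least [cm] clients, each costing [e^(- kap)], hence a factor at most [q].
    Before [m] pulls, this gain is offset by the exponent [m - pulls] dropping by one. *)
Lemma potential_step t w : V t.+1 w <=
  V t w * (A t.+1 w)%:R * (if (m <= pulls t w)%N then q else 1) * E (C t.+1 w) t w +
  V t w * (~~ A t.+1 w)%:R.
Proof.
rewrite /V /W pulls_rec arm_S_rec arm_N_rec; case: (A t.+1 w) => /=; last first.
  by rewrite addn0 mulr0 !mul0r add0r mulr1.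
rewrite mulr1 mulr0 addr0 addn1.
have -> : expR (lam * (S t w + \sum_(k < C t.+1 w) X k.+1 t.+1 w) -
    (N t w + C t.+1 w)%:R * (phi + kap)) =
    expR (lam * S t w - (N t w)%:R * (phi + kap)) * E (C t.+1 w) t w *
    expR (- ((C t.+1 w)%:R * kap)).
  by rewrite /E -!expRD; congr expR; rewrite natrD; ring.
have qC : expR (- ((C t.+1 w)%:R * kap)) <= q.
  rewrite ler_expR lerN2 ler_pM2r// ler_nat.
  by have /andP[] := C_bounds t.+1 w isT.
set a := expR (lam * _ - _); set e := E _ _ _; set x := expR _.
have a0 : 0 <= a by exact: expR_ge0.
have e0 : 0 <= e by exact: expR_ge0.
have qn j : 0 <= q ^+ j by rewrite exprn_ge0// expR_ge0.
case: leqP => mp.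
  have -> : (m - (pulls t w).+1 = 0)%N by apply/eqP; rewrite subn_eq0 leqW.
  have -> : (m - pulls t w = 0)%N by apply/eqP; rewrite subn_eq0.
  by rewrite expr0 !mulr1 mulrAC ler_pM2r ?expR_gt0// ler_wpM2l.
have -> : (m - pulls t w = (m - (pulls t w).+1).+1)%N by rewrite subnSK.
rewrite mulr1 exprS.
have -> : a * (q * q ^+ (m - (pulls t w).+1)) * e = a * e * q * q ^+ (m - (pulls t w).+1).
  by ring.
by rewrite ler_wpM2r// ler_wpM2l// mulr_ge0.
Qed.

(** Each round lowers the expected potential by at least [1 - q] times its mass on late pulls; these
    losses telescope from the initial value [q ^+ m]. *)
Lemma potential_bound n :
  (\int[P]_w (V n w)%:E + (1 - q)%:E *
     \sum_(t < n) \int[P]_w (V t w * (A t.+1 w && (m <= pulls t w)%N)%:R)%:E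
   <= (q ^+ m)%:E)%E.
Proof.
have q1 : q <= 1.
  by rewrite -[leRHS]expR0 ler_expR oppr_le0 mulr_ge0// ltW.
have q0 : 0 <= q by exact: expR_ge0.
have V0 t w : 0 <= V t w by rewrite mulr_ge0 ?expR_ge0// exprn_ge0.
have mp t := measurable_pulls t.
have mV t : measurable_fun setT (V t : from (past t) -> R).
  apply: measurable_funM; first exact: measurable_tilt_stats.
  exact: (@measurable_fun_nat_case _ (from (past t)) _ R (pulls t) (fun p _ => q ^+ (m - p))).
have mle t : measurable_fun setT ((fun w => (m <= pulls t w)%N) : from (past t) -> bool).
  exact: (@measurable_fun_nat_case _ (from (past t)) _ _ (pulls t) (fun p _ => (m <= p)%N)).
have mG t : measurable_fun setT
    ((fun w => V t w * (A t.+1 w && (m <= pulls t w)%N)%:R) : from (past t) -> R).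
  apply: measurable_funM => //; apply: measurable_boolr; apply: measurable_and => //.
  exact: measurable_A.
have toT t (f : T -> R) : measurable_fun setT (f : from (past t) -> R) ->
    measurable_fun setT (EFin \o f).
  by move=> mf; apply/measurable_EFinP; exact: (measurable_fun_from _ measurable_arm_var _ _ mf).
elim: n => [|n IH].
  rewrite big_ord0 mule0 adde0 (eq_integral (cst (q ^+ m)%:E)) => [|w _]; last first.
    by rewrite /V /W /pulls big_ord0 subn0 /S /N /= mulr0 mul0r subrr expR0 mul1r.
  rewrite integral_cst// [X in (_ * X)%E](_ : _ = 1%E) ?mule1//.
  exact: probability_setT.
apply: le_trans IH; rewrite big_ord_recr /= ge0_muleDr; last 2 first.
- apply: sume_ge0 => t _; apply: integral_ge0 => w _.
  by rewrite lee_fin mulr_ge0.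
- by apply: integral_ge0 => w _; rewrite lee_fin mulr_ge0.
rewrite addeCA [leRHS]addeC; apply: leeD => //.
rewrite -ge0_integralZl//; last 3 first.
- exact: (toT n).
- by move=> w _; rewrite lee_fin mulr_ge0.
- by rewrite lee_fin subr_ge0.
pose f1 w := V n w * (A n.+1 w)%:R * (if (m <= pulls n w)%N then q else 1).
pose f2 w := V n w * (~~ A n.+1 w)%:R.
have mA := measurable_A n.
have mf1 : measurable_fun setT (f1 : from (past n) -> R).
  apply: measurable_funM; last exact: measurable_fun_ifT.
  by apply: measurable_funM => //; exact: measurable_boolr.
have mf2 : measurable_fun setT (f2 : from (past n) -> R).
  apply: measurable_funM => //; apply: measurable_boolr.
  exact: (measurableT_comp (f := negb)).
have f10 w : 0 <= f1 w.
  by apply: mulr_ge0; [exact: mulr_ge0|case: (m <= pulls n w)%N].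
have f20 w : 0 <= f2 w by rewrite mulr_ge0.
have mE : measurable_fun setT (fun w => E (C n.+1 w) n w).
  apply: (@measurable_fun_nat_case _ _ _ _ (C n.+1) (fun k w => E k n w)).
    exact/(@measurable_fun_natr _ _ R).
  by move=> k; exact: measurable_tilt_total.
have mf1E : measurable_fun setT (fun w => (f1 w * E (C n.+1 w) n w)%:E).
  apply/measurable_EFinP; apply: measurable_funM => //.
  by apply/measurable_EFinP; exact: (toT n).
have E0 w : 0 <= E (C n.+1 w) n w by exact: expR_ge0.
apply: (@le_trans _ _ (\int[P]_w (f1 w)%:E + \int[P]_w (f2 w)%:E +
    \int[P]_w ((1 - q)%:E * (V n w * (A n.+1 w && (m <= pulls n w)%N)%:R)%:E))%E).
  apply: leeD => //; rewrite -(tilt_round n f1)// -ge0_integralD//; last 3 first.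
  - by move=> w _; rewrite lee_fin mulr_ge0.
  - by move=> w _; rewrite lee_fin.
  - exact: (toT n).
  apply: ge0_le_integral => //.
  - by move=> w _; rewrite lee_fin.
  - exact: (toT n.+1).
  - by apply: emeasurable_funD => //; exact: (toT n).
  - by move=> w _; rewrite -EFinD lee_fin; exact: potential_step.
rewrite -ge0_integralD//; last 4 first.
- by move=> w _; rewrite lee_fin.
- exact: (toT n).
- by move=> w _; rewrite lee_fin.
- exact: (toT n).
rewrite -ge0_integralD//; last 4 first.
- by move=> w _; rewrite -EFinD lee_fin addr_ge0.
- by apply: emeasurable_funD => //; exact: (toT n).
- by move=> w _; rewrite mule_ge0// lee_fin ?subr_ge0// mulr_ge0.
- by apply: emeasurable_funM => //; exact: (toT n).
rewrite le_eqVlt; apply/orP; left; apply/eqP; apply: eq_integral => w _.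
rewrite -EFinM -!EFinD; congr (_%:E); rewrite /f1 /f2.
by case: (A n.+1 w); case: (m <= pulls n w)%N => /=; ring.
Qed.

Lemma pulls_le_count n w :
  (pulls n w <= m + \sum_(t < n) (A t.+1 w && (m <= pulls t w)))%N.
Proof.
elim: n => [|n IH]; first by rewrite /pulls big_ord0.
rewrite pulls_rec big_ord_recr /= addnA; case: (A n.+1 w) => /=; last by rewrite !addn0.
case: (leqP m (pulls n w)) => mp; first exact: leq_add.
by rewrite addn1 addn0; exact: leq_trans mp (leq_addr _ _).
Qed.

(** The first [m] pulls are counted for free. At a later one the exponent [m - pulls] is 0, so
    [V = W >= 1] and [potential_bound] controls their expected number. *)
Lemma expected_pulls n :
  (forall t w, (t < n)%N -> A t.+1 w -> (m <= pulls t w)%N -> 1 <= W t w) ->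
  (\int[P]_w (pulls n w)%:R%:E <= (m%:R + q ^+ m / (1 - q))%:E)%E.
Proof.
move=> W1.
have q1 : 0 < 1 - q.
  by rewrite subr_gt0 -[ltRHS]expR0 ltr_expR oppr_lt0 mulr_gt0// ltr0n.
have mG t : measurable_fun setT
    ((fun w => (A t.+1 w && (m <= pulls t w)%N)%:R : R) : from (past t) -> R).
  apply: measurable_boolr; apply: measurable_and; first exact: measurable_A.
  apply: (@measurable_fun_nat_case _ (from (past t)) _ _ (pulls t) (fun p _ => (m <= p)%N)) => //.
  exact: measurable_pulls.
have toT t (f : T -> R) : measurable_fun setT (f : from (past t) -> R) ->
    measurable_fun setT (EFin \o f).
  by move=> mf; apply/measurable_EFinP; exact: (measurable_fun_from _ measurable_arm_var _ _ mf).
have mV t : measurable_fun setT (V t : from (past t) -> R).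
  apply: measurable_funM; first exact: measurable_tilt_stats.
  apply: (@measurable_fun_nat_case _ (from (past t)) _ R (pulls t) (fun p _ => q ^+ (m - p))) => //.
  exact: measurable_pulls.
have V0 t w : 0 <= V t w by rewrite mulr_ge0 ?expR_ge0// exprn_ge0// expR_ge0.
apply: (@le_trans _ _ (\int[P]_w (m%:R%:E +
    \sum_(t < n) (A t.+1 w && (m <= pulls t w)%N)%:R%:E))%E).
  apply: ge0_le_integral => //.
  - by apply: (toT n); apply: measurable_natr; exact: measurable_pulls.
  - by apply: emeasurable_funD => //; apply: emeasurable_sum => // t; exact: (toT t _ (mG t)).
  - move=> w _; rewrite sumEFin -EFinD lee_fin -natr_sum -natrD ler_nat.
    exact: pulls_le_count.
rewrite ge0_integralD//; last 2 first.
- by move=> w _; apply: sume_ge0 => t _; rewrite lee_fin.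
- by apply: emeasurable_sum => // t; exact: (toT t _ (mG t)).
rewrite integral_cst// [X in (_ * X + _)%E](_ : _ = 1%E); last exact: probability_setT.
rewrite mule1 EFinD; apply: leeD => //.
rewrite ge0_integral_sum//; last by move=> t; exact: (toT t).
rewrite mulrC EFinM lee_pdivlMl//.
apply: le_trans (potential_bound n).
apply: (@le_trans _ _ ((1 - q)%:E *
   \sum_(t < n) \int[P]_w (V t w * (A t.+1 w && (m <= pulls t w)%N)%:R)%:E)%E); last first.
  by rewrite leeDr//; apply: integral_ge0 => w _; rewrite lee_fin.
apply: lee_wpmul2l; first by rewrite lee_fin ltW.
apply: lee_sum => t _; apply: ge0_le_integral => //.
- exact: (toT t).
- by apply: (toT t); exact: measurable_funM.
- move=> w _; rewrite lee_fin; case: (boolP (A t.+1 w)) => //= At; last by rewrite mulr0.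
  case: leqP => // mp; last by rewrite mulr0.
  rewrite mulr1 /V (_ : m - pulls t w = 0)%N ?expr0 ?mulr1; first exact: W1.
  by apply/eqP; rewrite subn_eq0.
Qed.

End potential.

End tilting.

(** Each [b t] is decided by the rounds up to [t], hence independent of the arrivals of round
    [t.+1], whose mean is at most [ct]. *)
Lemma expected_clients n ct (b : nat -> T -> bool) :
  (forall t, measurable_fun setT (b t : from (past t) -> bool)) ->
  (forall t, (1 <= t <= n)%N -> \int[P]_w (C t w)%:R%:E <= ct%:E)%E ->
  (\int[P]_w (\sum_(t < n) b t w * C t.+1 w)%N%:R%:E <=
   ct%:E * \sum_(t < n) \int[P]_w (b t w)%:R%:E)%E.
Proof.
move=> mb hct.
have mbT t : measurable_fun setT (fun w => (b t w)%:R : R).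
  apply: measurable_boolr; exact: (measurable_fun_from _ measurable_arm_var _ _ (mb t)).
rewrite (eq_integral (fun w => \sum_(t < n) ((b t w)%:R * (C t.+1 w)%:R)%:E)%E); last first.
  by move=> w _; rewrite sumEFin natr_sum; congr (_%:E); apply: eq_bigr => t _; rewrite natrM.
rewrite ge0_integral_sum//; last first.
  by move=> t; apply/measurable_EFinP; apply: measurable_funM.
rewrite ge0_sume_distrr; last by move=> t _; apply: integral_ge0 => w _; rewrite lee_fin.
apply: lee_sum => t _; apply: indep_clients => //.
  by apply: measurable_boolr; exact: mb.
by apply: hct => /=.
Qed.

Lemma expected_arm_N n ct :
  (forall t, (1 <= t <= n)%N -> \int[P]_w (C t w)%:R%:E <= ct%:E)%E ->
  (\int[P]_w (N n w)%:R%:E <= ct%:E * \int[P]_w (pulls n w)%:R%:E)%E.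
Proof.
move=> hct.
under eq_integral do rewrite arm_N_sum.
apply: le_trans (expected_clients n ct _ measurable_A hct) _.
rewrite le_eqVlt; apply/orP; left; apply/eqP; congr (_ * _)%E.
rewrite -ge0_integral_sum//.
  by apply: eq_integral => w _; rewrite sumEFin /pulls natr_sum.
move=> t; apply/measurable_EFinP; apply: measurable_boolr.
exact: (measurable_fun_from _ measurable_arm_var _ _ (measurable_A t)).
Qed.

Lemma measurable_total_N t : measurable_fun setT (N t).
Proof.
have [mN _] := measurable_stats t.
exact: (measurable_fun_from _ measurable_arm_var _ _ mN).
Qed.

Lemma measurable_total_S t : measurable_fun setT (S t).
Proof.
have [_ mS] := measurable_stats t.
exact: (measurable_fun_from _ measurable_arm_var _ _ mS).
Qed.

Lemma expected_deficit n ct :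
  (forall t, (1 <= t <= n)%N -> \int[P]_w (C t w)%:R%:E <= ct%:E)%E ->
  (\int[P]_w ((\sum_(1 <= t < n.+1) C t w)%N%:R)%:E - \int[P]_w (N n w)%:R%:E <=
   ct%:E * \sum_(t < n) \int[P]_w (~~ A t.+1 w)%:R%:E)%E.
Proof.
move=> hct.
have mnA t : measurable_fun setT ((fun w => ~~ A t.+1 w) : from (past t) -> bool).
  exact: (measurableT_comp (f := negb) _ (measurable_A t)).
apply: le_trans (expected_clients n ct _ mnA hct).
have mD : measurable_fun setT (fun w => (\sum_(t < n) ~~ A t.+1 w * C t.+1 w)%N%:R%:E : \bar R).
  apply/measurable_EFinP.
  under eq_fun do rewrite natr_sum.
  apply: measurable_sum => t; under eq_fun do rewrite natrM.
  apply: measurable_funM => //; apply: measurable_boolr.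
  exact: (measurable_fun_from _ measurable_arm_var _ _ (mnA t)).
have mN : measurable_fun setT (fun w => (N n w)%:R%:E : \bar R).
  by apply/measurable_EFinP; apply: measurable_natr; exact: measurable_total_N.
(* Finiteness, from [N n <= n * cp], is what permits cancelling this expectation in the extended
   reals. *)
have finN : (\int[P]_w (N n w)%:R%:E)%E \is a fin_num.
  rewrite ge0_fin_numE; last by apply: integral_ge0 => w _; rewrite lee_fin.
  apply: (@le_lt_trans _ _ (\int[P]_w (cst (n * cp)%:R%:E) w)%E).
    by apply: ge0_le_integral => // w _; rewrite lee_fin ler_nat arm_N_le.
  rewrite integral_cst// [X in (_ * X)%E](_ : _ = 1%E) ?mule1 ?ltry//.
  exact: probability_setT.
rewrite (eq_integral (fun w => (N n w)%:R%:E +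
    (\sum_(t < n) ~~ A t.+1 w * C t.+1 w)%N%:R%:E)%E); last first.
  move=> w _; rewrite -EFinD -natrD; congr (_%:R%:E).
  rewrite arm_N_sum -big_split /= big_add1 big_mkord; apply: eq_bigr => t _.
  by case: (A t.+1 w); rewrite ?mul1n ?mul0n ?addn0.
by rewrite ge0_integralD// addeAC subee// add0e.
Qed.

(** * Self-normalised lower deviations by peeling *)

Section deviation.
Variables (Lam : set R) (phi : R -> R) (mu : R).
Hypothesis Lam_lt0 : forall lam, Lam lam -> lam < 0.
Hypothesis phi_ge : forall lam, Lam lam -> mu * lam <= phi lam.
Hypothesis mgfX : forall lam k t, Lam lam ->
  (\int[P]_w (expR (lam * X k.+1 t.+1 w - phi lam))%:E = 1)%E.
Variables (t : nat) (delta : R).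
Hypothesis cm_gt0 : (0 < cm)%N.
Hypothesis cp_gt0 : (0 < cp)%N.
Hypothesis t_gt0 : (0 < t)%N.
Hypothesis delta_gt0 : 0 < delta.
Hypothesis skip : forall w, ~~ A t.+1 w ->
  exists2 lam, Lam lam & delta < (N t w)%:R * (lam * (S t w / (N t w)%:R) - phi lam).

Let Z w := S t w / (N t w)%:R.
Let slice (k : nat) : set T :=
  [set w | expR (k%:R / delta) <= (N t w)%:R <= expR (k.+1%:R / delta)].
(** [delta] divided by the upper end of slice [k]: on that slice, a total deviation above [delta]
    forces a deviation per observation above [level k]. *)
Let level (k : nat) : R := delta * expR (- (k.+1%:R / delta)).
Let Q k : set R := [set x | exists2 lam, Lam lam & level k < lam * x - phi lam].

Lemma arm_N_gt0 w : (0 < N t w)%N.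
Proof.
apply: leq_trans (pulls_le t w); rewrite muln_gt0 cm_gt0 andbT.
by case: t t_gt0 => // t' _; exact: pulls_gt0.
Qed.

Lemma measurable_slice k : measurable (slice k).
Proof.
have mN := measurable_natr _ (measurable_total_N t).
have -> : slice k = (fun w => (N t w)%:R : R) @^-1`
    `[expR (k%:R / delta), expR (k.+1%:R / delta)].
  by apply/seteqP; split => w; rewrite /slice /= in_itv.
by rewrite -[X in measurable X]setTI; exact: mN.
Qed.

Lemma measurable_Z : measurable_fun setT Z.
Proof.
apply: (@measurable_fun_nat_case _ _ _ R (N t) (fun n w => S t w / n%:R)).
  exact: measurable_total_N.
by move=> n; apply: measurable_funM => //; exact: measurable_total_S.
Qed.

(** A positive deviation with [lam < 0] and [mu * lam <= phi lam] forces the empirical mean below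
    [mu]. *)
Lemma Q_bounded k : has_ubound (Q k).
Proof.
exists mu => x [lam Ll lx]; rewrite leNgt; apply/negP => mux.
have l0 := Lam_lt0 _ Ll; have ph := phi_ge _ Ll.
have : 0 < level k by rewrite mulr_gt0// expR_gt0.
nra.
Qed.

(** For [x] below the supremum, the tilt certifying some [y > x] in [Q k] works for all empirical
    means up to [x], since [lam < 0]. Markov's inequality is applied to its martingale. *)
Lemma slice_deviation k : Q k !=set0 ->
  (P (slice k `&` [set w | Z w < sup (Q k)])%R <= (expR (1 - delta))%:E)%E.
Proof.
move=> Q0.
have hs : has_sup (Q k) by split => //; exact: Q_bounded.
apply: probability_lt_le; first exact: measurable_slice.
  exact: measurable_Z.
move=> x xs.
have xs0 : 0 < sup (Q k) - x by rewrite subr_gt0.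
have [y [lam Ll ly]] := sup_adherent xs0 hs.
rewrite opprB addrC subrK => xy.
have l0 := Lam_lt0 _ Ll.
rewrite -[1 - delta]opprB expRN.
apply: (markov_bound P (fun w => expR (lam * S t w - (N t w)%:R * phi lam))).
- apply: measurableI; first exact: measurable_slice.
  have -> : [set w | Z w <= x] = Z @^-1` `]-oo, x].
    by apply/seteqP; split => w /=; rewrite in_itv.
  by rewrite -[X in measurable X]setTI; exact: measurable_Z.
- apply: (measurable_fun_from _ measurable_arm_var (past t)).
  exact: measurable_tilt_stats.
- by move=> w; exact: expR_ge0.
- exact: expR_gt0.
- move=> w [/andP[Nk _] /= Zx]; rewrite ler_expR.
  have N0 : 0 < (N t w)%:R :> R by rewrite ltr0n arm_N_gt0.
  have -> : lam * S t w - (N t w)%:R * phi lam = (N t w)%:R * (lam * Z w - phi lam).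
    by rewrite /Z; field; rewrite gt_eqF.
  have lZ : level k <= lam * Z w - phi lam.
    have : lam * y <= lam * Z w by rewrite ler_nM2l// (le_trans Zx)// ltW.
    lra.
  apply: (@le_trans _ _ (expR (k%:R / delta) * level k)); last first.
    by apply: ler_pM => //; rewrite mulr_ge0 ?expR_ge0 ?ltW.
  rewrite /level mulrCA -expRD.
  have -> : k%:R / delta - k.+1%:R / delta = - delta^-1.
    by rewrite -natr1; field; rewrite gt_eqF.
  (* The ratio of the two ends of a slice costs [e^(- 1/delta) >= 1 - 1/delta], leaving an exponent
     of at least [delta - 1]. *)
  apply: (@le_trans _ _ (delta * (1 - delta^-1))).
    by rewrite mulrBr mulr1 divff ?gt_eqF.
  by rewrite ler_pM2l//; exact: expR_ge1Dx.
- by rewrite tilt_stats// => k' t'; exact: mgfX.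
Qed.

(* Peeling: [N t] lies in a slice [e^(k/delta), e^((k+1)/delta)], on which a
   single tilting parameter suffices up to a constant factor [e]. *)
Lemma deviation_bound :
  (\int[P]_w (~~ A t.+1 w)%:R%:E <=
   ((delta * ln (t * cp)%:R + 1) * expR (1 - delta))%:E)%E.
Proof.
have mA : measurable_fun setT (A t.+1).
  exact: (measurable_fun_from _ measurable_arm_var _ _ (measurable_A t)).
have mnA : measurable [set w | ~~ A t.+1 w].
  have := mA measurableT [set false] I; rewrite setTI.
  by congr measurable; apply/seteqP; split => w /=; case: (A t.+1 w).
have ln0 : 0 <= delta * ln (t * cp)%:R :> R.
  by apply: mulr_ge0; [exact: ltW|rewrite ln_ge0// ler1n muln_gt0 t_gt0].
(* [N t <= t * cp] bounds the number of slices that can be reached. *)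
pose D := (Num.truncn (delta * ln (t * cp)%:R : R)).+1.
(* The supremum of an empty [Q k] would be a meaningless default value, so such slices are assigned
   the empty event. *)
pose B k : set T := if `[< Q k !=set0 >]
  then slice k `&` [set w | Z w < sup (Q k)] else set0.
have mB k : measurable (B k).
  rewrite /B; case: asboolP => // _; apply: measurableI; first exact: measurable_slice.
  have -> : [set w | Z w < sup (Q k)] = Z @^-1` `]-oo, sup (Q k)[.
    by apply/seteqP; split => w /=; rewrite in_itv.
  by rewrite -[X in measurable X]setTI; exact: measurable_Z.
have PB k : (P (B k) <= (expR (1 - delta))%:E)%E.
  rewrite /B; case: asboolP => [|_]; first exact: slice_deviation.
  by rewrite measure0 lee_fin expR_ge0.
rewrite (eq_integral (fun w => (\1_[set w | ~~ A t.+1 w] w)%:E)); last first.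
  move=> w _; rewrite indicE; congr (_%:R%:E).
  by case: (boolP (~~ A t.+1 w)) => h; [rewrite mem_set|rewrite memNset//; apply/negP].
rewrite integral_indic// setIT.
have sub : [set w | ~~ A t.+1 w] `<=` \big[setU/set0]_(k < D) B k.
  move=> w /skip [lam Ll dl].
  have N0 : 0 < (N t w)%:R :> R by rewrite ltr0n arm_N_gt0.
  have N1 : 1 <= (N t w)%:R :> R by rewrite ler1n arm_N_gt0.
  have lN0 : 0 <= delta * ln (N t w)%:R :> R by apply: mulr_ge0; [exact: ltW|exact: ln_ge0].
  pose k := Num.truncn (delta * ln (N t w)%:R : R).
  have /andP[k1 k2] := truncn_itv lN0.
  have kD : (k < D)%N.
    rewrite ltnS; apply: le_truncn; rewrite ler_pM2l// ler_ln ?posrE//.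
      by rewrite ler_nat arm_N_le.
    by rewrite ltr0n muln_gt0 t_gt0.
  rewrite -bigcup_mkord; exists k => //=.
  have sk : slice k w.
    rewrite /slice /= -[X in _ <= X <= _]lnK ?posrE// !ler_expR.
    by rewrite ler_pdivrMr// ler_pdivlMr// mulrC k1 /= ltW.
  have Qk : level k < lam * Z w - phi lam.
    have : level k * (N t w)%:R <= delta.
      rewrite /level -mulrA -[leRHS]mulr1 ler_pM2l// expRN mulrC ler_pdivrMr ?expR_gt0// mul1r.
      by have /andP[] := sk.
    move=> h; rewrite -(ltr_pM2r N0); apply: (le_lt_trans h).
    by rewrite mulrC.
  have l0 := Lam_lt0 _ Ll.
  have Q0 : Q k !=set0 by exists (Z w); exists lam.
  rewrite /B; case: asboolP => // _; split => //=.
  (* A point to the right of [Z w] that uses up half of the excess over [level k]: it is still in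
     [Q k], which makes [Z w < sup (Q k)] strict. *)
  pose z := Z w - (lam * Z w - phi lam - level k) / (2 * lam).
  have Qz : Q k z.
    exists lam => //; rewrite /z.
    have -> : lam * (Z w - (lam * Z w - phi lam - level k) / (2 * lam)) =
        lam * Z w - (lam * Z w - phi lam - level k) / 2.
      by field; rewrite lt_eqF.
    lra.
  apply: (@lt_le_trans _ _ z); last by apply: ub_le_sup => //; exact: Q_bounded.
  rewrite /z ltrDl oppr_gt0 pmulr_rlt0 ?subr_gt0// invr_lt0; lra.
apply: le_trans (le_measure P _ _ sub) _; rewrite ?inE//.
  by apply: bigsetU_measurable.
apply: le_trans (Boole_inequality P (fun i _ => mB i)) _.
apply: (@le_trans _ _ (\sum_(k < D) (expR (1 - delta))%:E)%E).
  by apply: lee_sum => k _; exact: PB.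
rewrite sumEFin lee_fin sumr_const card_ord -[leLHS]mulr_natl ler_pM2r ?expR_gt0//.
by rewrite /D -natr1 lerD2r truncn_le.
Qed.

End deviation.

End arm_process.

(** * Estimates for logarithms and iterated logarithms *)

Section logarithms.
Context {R : realType}.
Implicit Types x y a b c : R.

Lemma ln_le_subr1 x : 0 < x -> ln x <= x - 1.
Proof.
move=> x0; have := @le_ln1Dx R (x - 1).
by rewrite (_ : 1 + (x - 1) = x); [apply; lra|ring].
Qed.

Lemma expR1_le3 : expR 1 <= 3 :> R.
Proof.
(* The sixth power of [1 - 1/6 <= e^(-1/6)] is precise enough, as [(5/6)^6 >= 1/3]. *)
have h : 5 / 6 <= expR (- (1 / 6)) :> R.
  by have := @expR_ge1Dx R (- (1 / 6)); lra.
have h6 : (5 / 6) ^+ 6 <= expR (- 1) :> R.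
  rewrite (_ : - 1 = 6%:R * - (1 / 6)) ?expRM_natl; last by field.
  by apply: lerXn2r => //; rewrite nnegrE ?expR_ge0//; lra.
rewrite -[leLHS]invrK -expRN -[leRHS]invrK lef_pV2 ?posrE ?expR_gt0 ?invr_gt0//.
by apply: le_trans h6; lra.
Qed.

Lemma ln_ge1 x : 3 <= x -> 1 <= ln x.
Proof.
move=> x3; rewrite -[leLHS]expRK ler_ln ?posrE ?expR_gt0//.
  by apply: le_trans x3; exact: expR1_le3.
by apply: lt_le_trans x3.
Qed.

(** Two uses of [ln u <= u - 1], at [ln a / ln b] and at [a / b], replace the comparison with the
    integral of [1 / (x ln x)]. It makes the sum of [1 / (t ln t)] telescope. *)
Lemma lnln_increment a b : 1 < a -> a <= b ->
  (b - a) / (b * ln b) <= ln (ln b) - ln (ln a).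
Proof.
move=> a1 ab.
have a0 : 0 < a by lra.
have b0 : 0 < b by lra.
have la : 0 < ln a by exact: ln_gt0.
have lb : 0 < ln b by apply: ln_gt0; lra.
have h1 := ln_le_subr1 (ln a / ln b) (divr_gt0 la lb).
have h2 := ln_le_subr1 (a / b) (divr_gt0 a0 b0).
rewrite ln_div ?posrE// in h1; rewrite ln_div ?posrE// in h2.
apply: (@le_trans _ _ (1 - ln a / ln b)); last lra.
have -> : 1 - ln a / ln b = (ln b - ln a) / ln b.
  by rewrite mulrBl divff// lt0r_neq0.
rewrite invfM mulrA ler_pM2r ?invr_gt0// mulrBl divff ?lt0r_neq0//; lra.
Qed.

(** With [l = ln t], [c >= 3] gives [e^(- delta) <= 1 / (t l^3)], while [ln (t cp) <= 2 l] and
    [ln l <= l] bound the polynomial factor by [(2 c + 3) l^2]. *)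
Lemma skip_term_bound c (t cp : nat) (delta := ln t%:R + c * ln (ln t%:R)) :
  (3 <= t)%N -> (0 < cp <= t)%N -> 3 <= c ->
  (delta * ln (t * cp)%:R + 1) * expR (1 - delta) <=
  expR 1 * (2 * c + 3) / (t%:R * ln t%:R).
Proof.
move=> t3 /andP[cp0 cpt] c3.
have tR3 : 3 <= t%:R :> R by rewrite ler_nat.
have t0 : 0 < t%:R :> R by lra.
have cpR0 : 0 < cp%:R :> R by rewrite ltr0n.
have l1 := ln_ge1 t%:R tR3; rewrite /delta; move: l1.
have -> : expR (1 - (ln t%:R + c * ln (ln t%:R))) =
    expR 1 * t%:R^-1 * expR (- (c * ln (ln t%:R))).
  by rewrite opprD addrA !expRD (expRN (ln t%:R)) lnK ?posrE.
have : ln (t * cp)%:R <= 2 * ln t%:R :> R.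
  rewrite natrM lnM ?posrE// mulr_natl mulr2n lerD2l ler_ln ?posrE//.
  by rewrite ler_nat.
set l := ln t%:R => lcp l1.
have l0 : 0 < l by lra.
have ll0 : 0 <= ln l by exact: ln_ge0.
have lll : ln l <= l by have := ln_le_subr1 l l0; lra.
have e3 : expR (- (c * ln l)) <= l ^- 3.
  have -> : l ^- 3 = expR (- (3 * ln l)).
    by rewrite expRN expRM_natl lnK ?posrE.
  by rewrite ler_expR lerN2 ler_wpM2r.
have poly : (l + c * ln l) * ln (t * cp)%:R + 1 <= (2 * c + 3) * l ^+ 2.
  have h1 : (l + c * ln l) * ln (t * cp)%:R <= (l + c * ln l) * (2 * l).
    apply: ler_wpM2l => //; apply: addr_ge0; first exact: ltW.
    by apply: mulr_ge0 => //; lra.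
  have h2 : c * ln l * (2 * l) <= c * l * (2 * l).
    by rewrite ler_wpM2r ?ler_wpM2l//; lra.
  have h3 : 1 <= l ^+ 2 by rewrite expr_ge1// ltW.
  apply: (@le_trans _ _ ((l + c * l) * (2 * l) + l ^+ 2)); last first.
    by rewrite le_eqVlt; apply/orP; left; apply/eqP; ring.
  by clear -h1 h2 h3; lra.
apply: (@le_trans _ _ ((2 * c + 3) * l ^+ 2 * (expR 1 * t%:R^-1 * l ^- 3))).
  apply: ler_pM => //.
  - apply: addr_ge0 => //; apply: mulr_ge0; first by rewrite addr_ge0 ?mulr_ge0//; lra.
    by rewrite ln_ge0// ler1n muln_gt0 (leq_trans _ t3).
  - by apply: ler_wpM2l => //; rewrite mulr_ge0 ?expR_ge0// invr_ge0 ltW.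
rewrite le_eqVlt; apply/orP; left; apply/eqP; field.
by rewrite !lt0r_neq0.
Qed.

Lemma exploration_le c (t n : nat) : 0 < c -> (1 <= t <= n)%N -> (3 <= n)%N ->
  ln t%:R + c * ln (ln t%:R) <= ln n%:R + c * ln (ln n%:R) :> R.
Proof.
move=> c0 /andP[t1 tn] n3.
have nR3 : 3 <= n%:R :> R by rewrite ler_nat.
have l1 := ln_ge1 n%:R nR3.
have ll0 : 0 <= ln (ln n%:R) :> R by exact: ln_ge0.
(* At [t = 1] both terms vanish, [ln 0] being 0 by convention; from [t = 2] on, [ln t > 0] and the
   iterated logarithm is monotone. *)
have := t1; rewrite leq_eqVlt => /orP[/eqP <-|t2].
  rewrite ln1 ln0// mulr0 addr0 addr_ge0 ?mulr_ge0//; lra.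
have tR : 1 < t%:R :> R by rewrite ltr1n.
have lt : 0 < ln t%:R :> R by exact: ln_gt0.
have lln : ln t%:R <= ln n%:R :> R by rewrite ler_ln ?posrE ?ler_nat//; lra.
by rewrite lerD// ler_pM2l// ler_ln ?posrE//; lra.
Qed.

End logarithms.

(** * The two bounds for a single arm *)

Section kl_ucb.
Context {R : realType}.
Variables (rho : {measure set R -> \bar R}) (Afun : R -> R)
  (th_lo th_hi : \bar R) (F : R -> R) (c : R).
Hypothesis efA : exp_family_assumptions rho Afun th_lo th_hi F.

Local Notation Th := (Theta th_lo th_hi).
Local Notation mean := (ef_mean rho Afun F).
Local Notation index := (klucb4p_index rho Afun th_lo th_hi F c).
Local Notation kl := (kl_div rho Afun th_lo th_hi F).

Definition iid_arm {d : measure_display} {T : measurableType d}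
    (P : probability T R) (th : R) (cm cp : nat) (C : nat -> T -> nat)
    (X : nat -> nat -> T -> R) : Prop :=
  [/\ (forall t w, (1 <= t)%N -> (cm <= C t w <= cp)%N),
      (forall t, measurable_fun setT (fun w => (C t w)%:R : R)),
      (forall k t, measurable_fun setT (X k t)),
      (forall k t B, (1 <= k)%N -> (1 <= t)%N -> measurable B ->
         P (X k t @^-1` B) = ef_law rho Afun F th B) &
      mutually_independent P (arm_var C X)].

Lemma iid_arm_mgf {d : measure_display} {T : measurableType d}
    (P : probability T R) th cm cp (C : nat -> T -> nat)
    (X : nat -> nat -> T -> R) lam k t :
  iid_arm P th cm cp C X -> Th th -> Th (th + lam) ->
  (\int[P]_w (expR (lam * X k.+1 t.+1 w - (F (th + lam) - F th)))%:E = 1)%E.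
Proof.
move=> [_ _ mX lawX _] Tth Tl.
have := ef_mgf rho Afun th_lo th_hi F efA P (X k.+1 t.+1) th (th + lam) Tth Tl (mX _ _).
rewrite (_ : th + lam - th = lam); last by ring.
by apply => B mB; exact: lawX.
Qed.

(** The deficit is at most [ct] times the sum of the skipping probabilities [p t]: early ones are
    bounded by 1, the others by [K / (t ln t)], which telescopes to [ln ln n]. *)
Lemma profitable_bound {d : measure_display} {T : measurableType d}
    (P : probability T R) th (tau : R) cm cp (C : nat -> T -> nat)
    (X : nat -> nat -> T -> R) (n : nat) (ct : R) :
  iid_arm P th cm cp C X -> Th th -> (0 < cm <= cp)%N -> tau < mean th ->
  (maxn 3 cp <= n)%N -> 3 <= c -> 0 <= ct ->
  (forall t, (1 <= t <= n)%N -> \int[P]_w (C t w)%:R%:E <= ct%:E)%E ->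
  (\int[P]_w ((\sum_(1 <= t < n.+1) C t w)%N%:R)%:E
     - \int[P]_w (arm_N index tau (fun s => C s w) (fun k s => X k s w) n)%:R%:E <=
    (ct * (expR 1 * (2 * c + 3) * ln (ln n%:R) + cp%:R + 3))%:E)%E.
Proof.
move=> iidX Tth /andP[cm0 cmcp] taum; rewrite geq_max => /andP[n3 cpn] c3 ct0 hct.
have [Cb mC mX lawX ind] := iidX.
have cp0 : (0 < cp)%N by exact: leq_trans cmcp.
have mu_ge k t : measurable_fun setT (fun m => (tau%:E <= index k m t)%E).
  exact: (measurable_index_ge rho Afun th_lo th_hi F efA).
apply: le_trans (expected_deficit P index tau cm cp C X Cb mC mX ind mu_ge n ct hct) _.
rewrite EFinM; apply: lee_wpmul2l; first by rewrite lee_fin.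
pose p t : \bar R := (\int[P]_w (~~ in_A index tau (fun s => C s w)
  (fun k s => X k s w) t.+1)%:R%:E)%E.
rewrite -[leLHS]/(\sum_(t < n) p t)%E.
have p0 t : (0 <= p t)%E by apply: integral_ge0 => w _; rewrite lee_fin.
have mA t : measurable_fun setT (fun w => in_A index tau (fun s => C s w)
    (fun k s => X k s w) t.+1).
  apply: (measurable_fun_from _ (measurable_arm_var C X mC mX) (past t)).
  exact: (measurable_A index tau C X mu_ge).
have p1 t : (p t <= 1)%E.
  apply: (@le_trans _ _ (\int[P]_w (cst 1%:E) w)%E).
    apply: ge0_le_integral => //.
    - apply/measurable_EFinP; apply: measurable_boolr.
      exact: (measurableT_comp (f := negb)).
    - by move=> w _; rewrite lee_fin lern1 leq_b1.
  by rewrite integral_cst// mul1e probability_le1.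
pose K := expR 1 * (2 * c + 3).
have K0 : 0 <= K by rewrite mulr_ge0 ?expR_ge0//; lra.
have pK t : (3 <= t)%N -> (cp <= t)%N -> (p t <= (K / (t%:R * ln t%:R))%:E)%E.
  move=> t3 cpt.
  have tR3 : 3 <= t%:R :> R by rewrite ler_nat.
  have l1 := ln_ge1 t%:R tR3.
  have dl0 : 0 < ln t%:R + c * ln (ln t%:R).
    by rewrite ltr_wpDr ?mulr_ge0 ?ln_ge0//; lra.
  have t0 : (0 < t)%N by exact: leq_trans t3.
  apply: (@le_trans _ _ (((ln t%:R + c * ln (ln t%:R)) * ln (t * cp)%:R + 1) *
      expR (1 - (ln t%:R + c * ln (ln t%:R))))%:E); last first.
    by rewrite lee_fin skip_term_bound// cp0.
  apply: (deviation_bound P index tau cm cp C X Cb mC mX ind mu_ge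
    [set lam | lam < 0 /\ Th (th + lam)] (fun lam => F (th + lam) - F th) (mean th)) => //.
  - by move=> lam [].
  - move=> lam [_ Tl]; have := ef_subgradient _ _ _ _ _ efA th (th + lam) Tth Tl.
    by rewrite (_ : th + lam - th = lam)//; ring.
  - by move=> lam k t' [_ Tl]; exact: (iid_arm_mgf P th cm cp C).
  (* A skip means an index below [tau < mean th], so [index_lt_deviation] supplies [s < th], that is
     the negative tilt [s - th]. *)
  - move=> w; rewrite /in_A /in_next /= negb_or => /andP[_ nA].
    have N0 := arm_N_gt0 index tau cm cp C X Cb t cm0 t0 w.
    have [s [Ts sth Ls]] := index_lt_deviation _ _ _ _ _ efA c _ _ t tau th Tth taum
      (ltW dl0) N0 nA.
    exists (s - th); first by split; rewrite ?subr_lt0// addrC subrK.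
    by rewrite [th + _]addrC subrK.
(* From this round on [pK] applies; the [m0 + 1] terms up to it are bounded by 1 each, and
   [m0 + 1 <= cp + 3] because [cp >= 1]. *)
pose m0 := maxn 3 cp.
have m03 : (3 <= m0)%N by exact: leq_maxl.
have m0cp : (cp <= m0)%N by exact: leq_maxr.
have sums k : (\sum_(t < (m0 + k).+1) p t <=
    (m0.+1%:R + K * (ln (ln (m0 + k)%:R) - ln (ln m0%:R)))%:E)%E.
  elim: k => [|k IH].
    rewrite addn0 subrr mulr0 addr0.
    apply: (@le_trans _ _ (\sum_(t < m0.+1) 1%:E)%E); first by apply: lee_sum.
    by rewrite sumEFin sumr_const card_ord.
  rewrite addnS big_ord_recr /=.
  have m3 : (3 <= (m0 + k).+1)%N by rewrite leqW// (leq_trans m03)// leq_addr.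
  have mcp : (cp <= (m0 + k).+1)%N by rewrite leqW// (leq_trans m0cp)// leq_addr.
  apply: le_trans (leeD IH (pK _ m3 mcp)) _.
  rewrite -EFinD lee_fin.
  have a1 : 1 < (m0 + k)%:R :> R by rewrite ltr1n (leq_trans _ (leq_addr _ _))// ltnW.
  have ab : (m0 + k)%:R <= (m0 + k).+1%:R :> R by rewrite ler_nat.
  have := lnln_increment _ _ a1 ab.
  have -> : (m0 + k).+1%:R - (m0 + k)%:R = 1 :> R by rewrite -natr1 addrC addKr.
  move=> /(ler_wpM2l K0); move: (ln (ln (m0 + k)%:R)) (ln (ln (m0 + k).+1%:R)) => x y.
  move: (ln (ln m0%:R)) (m0.+1%:R) ((m0 + k).+1%:R * _) => z1 z2 z3.
  by rewrite mul1r mulrBr; lra.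
have m0n : (m0 <= n)%N by rewrite geq_max n3.
have := sums (n - m0)%N; rewrite subnKC// big_ord_recr /= => sn.
(* [p t] concerns round [t.+1], so the deficit stops at [p n.-1]; adding the nonnegative [p n]
   matches the range of [sums]. *)
apply: (@le_trans _ _ (\sum_(t < n) p t + p n)%E); first by rewrite leeDl.
apply: (le_trans sn); rewrite lee_fin.
have llm0 : 0 <= ln (ln m0%:R) :> R by rewrite ln_ge0// ln_ge1// ler_nat.
have m0R : m0.+1%:R <= cp%:R + 3 :> R.
  rewrite -natrD ler_nat /m0; case: (leqP 3 cp) => h; first by rewrite addn3 leqW// leqW.
  by rewrite addn3 !ltnS.
have := mulr_ge0 K0 llm0; rewrite -/K; lra.
Qed.

(** [H] and [b] are fixed before the probability space, the horizon and [cp]. After about [x] pulls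
    the index can reach [mean t0] only if the empirical mean is at least [r], and [expected_pulls]
    counts these late pulls. *)
Lemma non_profitable_bound th t0 eps (cm : nat) :
  Th th -> Th t0 -> th < t0 -> 0 < eps -> 0 < c -> (0 < cm)%N ->
  exists H b : R, [/\ 0 < H, 0 < b &
    forall (d : measure_display) (T : measurableType d) (P : probability T R)
      (cp : nat) (C : nat -> T -> nat) (X : nat -> nat -> T -> R) (n : nat) (ct : R),
    iid_arm P th cm cp C X -> 0 <= ct -> (1 <= n)%N ->
    (forall t, (1 <= t <= n)%N -> \int[P]_w (C t w)%:R%:E <= ct%:E)%E ->
    (\int[P]_w (arm_N index (mean t0) (fun s => C s w) (fun k s => X k s w) n)%:R%:E <=
      ((1 + eps) * (ct * (ln n%:R + c * ln (ln n%:R)))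
          / (cm%:R * kl (mean th) (mean t0)) + ct * (1 + H / n%:R `^ b))%:E)%E].
Proof.
move=> Tth Tt0 tht0 eps0 c0 cm0.
have D0 := kl_div_gt0 _ _ _ _ _ efA th t0 Tth Tt0 tht0.
have [r [lam [kap [lam0 kap0 Tlam kapE dev]]]] :=
  index_ge_deviation _ _ _ _ _ efA th t0 c eps Tth Tt0 tht0 eps0.
set D := kl _ _ in D0 dev *.
have cmR : 0 < cm%:R :> R by rewrite ltr0n.
pose q := expR (- (cm%:R * kap)).
have q1 : 0 < 1 - q by rewrite subr_gt0 -[ltRHS]expR0 ltr_expR oppr_lt0 mulr_gt0.
(* Chosen so that [q^x = e^(- b L)], which is at most [n^(- b)] for [n >= 3]. *)
pose b := kap * (1 + eps) / D.
have b0 : 0 < b by rewrite divr_gt0// mulr_gt0// addr_gt0.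
(* Needed at [n = 2] only: [ln (ln 2) < 0] can make the leading term negative, and [G] absorbs it,
   the factor [2 ^ b] cancelling the denominator. *)
pose G := 1 + (1 + eps) * `|c * ln (ln 2)| / (cm%:R * D).
have G1 : 1 <= G by rewrite lerDl !mulr_ge0 ?invr_ge0 ?mulr_ge0//; lra.
exists ((1 - q)^-1 + 2 `^ b * G), b; split => //.
  by rewrite addr_gt0 ?invr_gt0// mulr_gt0 ?powR_gt0//; lra.
move=> d T P cp C X n ct iidX ct0 n1 hct.
have [Cb mC mX lawX ind] := iidX.
have mu_ge k t : measurable_fun setT (fun m => ((mean t0)%:E <= index k m t)%E).
  exact: (measurable_index_ge rho Afun th_lo th_hi F efA).
apply: le_trans (expected_arm_N P index (mean t0) C X mC mX ind mu_ge n ct hct) _.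
suff : (\int[P]_w (pulls index (mean t0) C X n w)%:R%:E <=
    ((1 + eps) * (ln n%:R + c * ln (ln n%:R)) / (cm%:R * D) +
     (1 + ((1 - q)^-1 + 2 `^ b * G) / n%:R `^ b))%:E)%E.
  have ctE : (0 <= ct%:E)%E by rewrite lee_fin.
  move=> /(lee_wpmul2l ctE) /le_trans; apply; rewrite -EFinM lee_fin le_eqVlt.
  by apply/orP; left; apply/eqP; rewrite mulrDr; congr (_ + _); rewrite !mulrA; congr (_ / _);
    rewrite -!mulrA mulrCA.
have trivial_bound : (\int[P]_w (pulls index (mean t0) C X n w)%:R%:E <= n%:R%:E)%E.
  apply: (@le_trans _ _ (\int[P]_w (cst n%:R%:E) w)%E).
    apply: ge0_le_integral => //.
    - apply/measurable_EFinP; apply: measurable_natr.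
      apply: (measurable_fun_from _ (measurable_arm_var C X mC mX) (past n)).
      exact: measurable_pulls.
    - move=> w _; rewrite lee_fin ler_nat /pulls.
      by rewrite (leq_trans (leq_sum _ (fun i _ => leq_b1 _)))// sum1_card card_ord.
  rewrite integral_cst// [X in (_ * X)%E](_ : _ = 1%E) ?mule1//.
  exact: probability_setT.
have pw0 : 0 < n%:R `^ b by rewrite powR_gt0// ltr0n.
have cD0 : 0 < cm%:R * D by rewrite mulr_gt0.
have H0 : 0 <= (1 - q)^-1 by rewrite invr_ge0 ltW.
have pb0 : 0 <= 2 `^ b :> R by exact: powR_ge0.
have [n3|n3] := ltnP n 3.
  apply: (le_trans trivial_bound); rewrite lee_fin.
  (* At [n = 1] the leading term is 0 by the convention [ln 0 = 0], and the constant 1 covers the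
     single pull. *)
  have [->|->] : n = 1%N \/ n = 2%N by case: n n1 n3 {hct trivial_bound pw0} => [|[|[|]]]; auto.
    rewrite ln1 ln0// mulr0 addr0 mulr0 mul0r add0r lerDl divr_ge0 ?powR_ge0//.
    by rewrite addr_ge0// mulr_ge0//; lra.
  have p2 : 0 < 2 `^ b :> R by rewrite powR_gt0.
  have -> : ((1 - q)^-1 + 2 `^ b * G) / 2 `^ b = (1 - q)^-1 / 2 `^ b + G.
    by rewrite mulrDl mulrAC divff ?mul1r// lt0r_neq0.
  have h1 : 0 <= (1 - q)^-1 / 2 `^ b by rewrite divr_ge0.
  have h2 : - ((1 + eps) * `|c * ln (ln 2)| / (cm%:R * D)) <=
      (1 + eps) * (ln 2 + c * ln (ln 2)) / (cm%:R * D).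
    rewrite -mulNr ler_pM2r ?invr_gt0// -mulrN ler_pM2l; last by rewrite addr_gt0.
    have l2 : 0 <= ln 2 :> R by rewrite ln_ge0// ler1n.
    have := ler_norm (- (c * ln (ln 2))); rewrite normrN; lra.
  move: h1 h2; rewrite /G; lra.
have nR3 : 3 <= n%:R :> R by rewrite ler_nat.
have l1 := ln_ge1 n%:R nR3.
pose L := ln n%:R + c * ln (ln n%:R).
have lln0 : 0 <= c * ln (ln n%:R) by rewrite mulr_ge0 ?ln_ge0// ltW.
have L0 : 0 <= L by rewrite /L; lra.
pose x := (1 + eps) * L / (cm%:R * D).
have x0 : 0 <= x by rewrite /x !mulr_ge0// ?invr_ge0 ?ltW// addr_gt0.
have /andP[x1 x2] := truncn_itv x0.
(* The least integer above [x]: then [m * cm] observations exceed the threshold in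
   [index_ge_deviation], and rounding up costs the constant 1 of the bound. *)
pose m := (Num.truncn x).+1.
apply: (@le_trans _ _ (m%:R + q ^+ m / (1 - q))%:E).
  apply: (expected_pulls P index (mean t0) cm cp C X Cb mC mX ind mu_ge lam
    (F (th + lam) - F th)) => //.
    by move=> k t; exact: (iid_arm_mgf P th cm cp C).
  (* At a late pull the empirical mean is at least [r], so [kap <= lam r - phi] makes the exponent
     of the potential nonnegative. *)
  move=> t w tn At mp.
  have t1 : (0 < t)%N by case: t At mp {tn} => // _; rewrite /pulls big_ord0.
  have pN := pulls_le index (mean t0) cm cp C X Cb t w.
  have mN : (m * cm <= arm_N index (mean t0) (fun s => C s w) (fun k s => X k s w) t)%N.
    by apply: leq_trans pN; rewrite leq_mul2r mp orbT.
  move: At; rewrite /in_A /in_next /= -[_ == _]negbK -lt0n t1 /=.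
  move: mN; rewrite /arm_N; set st := arm_stats _ _ _ _ _ => mN At.
  have N0 : (0 < st.1)%N by apply: leq_trans mN; rewrite muln_gt0.
  have NR : 0 < st.1%:R :> R by rewrite ltr0n.
  have rm : r <= st.2 / st.1%:R.
    apply: (dev st.1 _ t N0 At).
    apply: (@le_lt_trans _ _ L).
      by apply: exploration_le => //; rewrite t1 ltnW.
    apply: (@lt_le_trans _ _ ((m * cm)%:R * (D / (1 + eps)))); last first.
      by rewrite ler_pM2r ?ler_nat// divr_gt0// addr_gt0.
    rewrite natrM.
    have -> : m%:R * cm%:R * (D / (1 + eps)) = m%:R * (cm%:R * D / (1 + eps)) by ring.
    rewrite -ltr_pdivrMr; last by rewrite divr_gt0// addr_gt0.
    by rewrite invf_div mulrA [L * _]mulrC.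
  rewrite -[leLHS]expR0 ler_expR.
  have -> : lam * st.2 - st.1%:R * (F (th + lam) - F th + kap) =
      st.1%:R * (lam * (st.2 / st.1%:R) - (F (th + lam) - F th) - kap).
    by field; rewrite lt0r_neq0.
  apply: mulr_ge0; first exact: ltW.
  have := ler_wpM2l (ltW lam0) rm; move: kapE; clear; lra.
rewrite lee_fin -/L -/x.
have mx : m%:R <= x + 1 by rewrite /m -natr1 lerD2r.
(* [x * (cm * kap) = b * L] and [ln n <= L]. *)
have qm : q ^+ m <= (n%:R `^ b)^-1.
  rewrite /powR gt_eqF; last lra.
  rewrite -expRN -expRM_natl ler_expR mulrN lerN2.
  apply: (@le_trans _ _ (x * (cm%:R * kap))); last first.
    by rewrite ler_pM2r ?mulr_gt0// ltW.
  have -> : x * (cm%:R * kap) = b * L.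
    by rewrite /x /b; field; rewrite !lt0r_neq0.
  rewrite ler_pM2l// /L; lra.
have h1 : q ^+ m / (1 - q) <= (1 - q)^-1 / n%:R `^ b.
  by rewrite mulrC ler_wpM2l.
have h2 : 0 <= 2 `^ b * G / n%:R `^ b.
  apply: divr_ge0; last exact: ltW.
  by apply: mulr_ge0 => //; exact: le_trans G1.
by apply: le_trans (lerD mx h1) _; rewrite mulrDl !addrA lerDl.
Qed.

End kl_ucb.

(** * Reduction of the bandit to its arms, with uniform constants for part (i) *)

Theorem theorem2 (R : realType)
  (rho : {measure set R -> \bar R}) (Afun : R -> R) (th_lo th_hi : \bar R)
  (F : R -> R) (c : R) :
  exp_family_assumptions rho Afun th_lo th_hi F -> 0 < c ->
  (* (i) non-profitable arms *)
  (exists H1 beta1 : R -> nat -> R -> R -> R,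
     (forall eps cm mu tau, 0 < eps < 1 ->
        0 < H1 eps cm mu tau /\ 0 < beta1 eps cm mu tau) /\
     forall (d : measure_display) (Omega : measurableType d)
       (P : probability Omega R) (K : nat) (theta : 'I_K -> R) (tau : 'I_K -> R)
       (cm cp : 'I_K -> nat) (C : 'I_K -> nat -> Omega -> nat)
       (X : 'I_K -> nat -> nat -> Omega -> R),
     profitable_bandit rho Afun th_lo th_hi F P theta cm cp C X ->
     forall (a : 'I_K), ef_mean rho Afun F (theta a) < tau a ->
     mean_set rho Afun th_lo th_hi F (tau a) ->
     forall (eps : R), 0 < eps < 1 ->
     forall (T : nat) (ct : R), (1 <= T)%N ->
     (cm a)%:R <= ct <= (cp a)%:R ->
     (forall t, (1 <= t <= T)%N -> (\int[P]_w ((C a t w)%:R)%:E <= ct%:E)%E) ->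
     (\int[P]_w ((klucb4p_N Afun rho th_lo th_hi F c tau C X a T w)%:R)%:E <=
       ((1 + eps) * (ct * (ln T%:R + c * ln (ln T%:R)))
          / ((cm a)%:R * kl_div rho Afun th_lo th_hi F
                           (ef_mean rho Afun F (theta a)) (tau a))
        + ct * (1 + H1 eps (cm a) (ef_mean rho Afun F (theta a)) (tau a)
                    / (T%:R `^ beta1 eps (cm a) (ef_mean rho Afun F (theta a)) (tau a))))%:E)%E)
  /\
  (* (ii) profitable arms *)
  (forall (d : measure_display) (Omega : measurableType d)
     (P : probability Omega R) (K : nat) (theta : 'I_K -> R) (tau : 'I_K -> R)
     (cm cp : 'I_K -> nat) (C : 'I_K -> nat -> Omega -> nat)
     (X : 'I_K -> nat -> nat -> Omega -> R),
   profitable_bandit rho Afun th_lo th_hi F P theta cm cp C X ->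
   forall (a : 'I_K), tau a < ef_mean rho Afun F (theta a) ->
   forall (T : nat) (ct : R), (maxn 3 (cp a) <= T)%N -> 3 <= c ->
   (cm a)%:R <= ct <= (cp a)%:R ->
   (forall t, (1 <= t <= T)%N -> (\int[P]_w ((C a t w)%:R)%:E <= ct%:E)%E) ->
   (\int[P]_w ((\sum_(1 <= t < T.+1) C a t w)%N%:R)%:E
      - \int[P]_w ((klucb4p_N Afun rho th_lo th_hi F c tau C X a T w)%:R)%:E <=
    (ct * (expR 1 * (2 * c + 3) * ln (ln T%:R) + (cp a)%:R + 3))%:E)%E).

Proof.
move=> efA c0; split; last first.
  move=> d Omega P K theta tau cm cp C X [K2 Tth cmcp [Cb mC mX lawX ind]] a taum T ct
    Tcp c3 /andP[ct1 ct2] hct.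
  apply: (profitable_bound rho Afun th_lo th_hi F c efA P (theta a) (tau a) (cm a)) => //.
  - by split; [exact: (Cb a)|exact: (mC a)|exact: (mX a)|exact: (lawX a)|exact: (ind a)].
  - by apply: le_trans ct1.
(* [good] states the bound uniformly over all probability spaces, arms and horizons, so that the
   choice of constants depends on [eps], [cm], [mu] and [tau] alone. *)
pose good (x : R * nat * R * R) (y : R * R) := let: (eps, cm, mu, tau) := x in
  0 < eps < 1 -> [/\ 0 < y.1, 0 < y.2 & forall th t0, Theta th_lo th_hi th ->
  Theta th_lo th_hi t0 -> th < t0 -> (0 < cm)%N ->
  mu = ef_mean rho Afun F th -> tau = ef_mean rho Afun F t0 ->
    forall (d : measure_display) (T : measurableType d) (P : probability T R)
      (cp : nat) (C : nat -> T -> nat) (X : nat -> nat -> T -> R) (n : nat) (ct : R),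
    iid_arm rho Afun F P th cm cp C X -> 0 <= ct -> (1 <= n)%N ->
    (forall t, (1 <= t <= n)%N -> \int[P]_w (C t w)%:R%:E <= ct%:E)%E ->
    (\int[P]_w (arm_N (klucb4p_index rho Afun th_lo th_hi F c) tau
       (fun s => C s w) (fun k s => X k s w) n)%:R%:E <=
      ((1 + eps) * (ct * (ln n%:R + c * ln (ln n%:R)))
          / (cm%:R * kl_div rho Afun th_lo th_hi F mu tau) +
       ct * (1 + y.1 / n%:R `^ y.2))%:E)%E].
have [f fP] : {f & forall x, good x (f x)}.
  apply: choice => -[[[eps cm] mu] tau].
  have [[th [t0 [Tth Tt0 tht0 eps0 [cm0 -> ->]]]]|no] := pselect (exists th t0,
    [/\ Theta th_lo th_hi th, Theta th_lo th_hi t0, th < t0, 0 < eps &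
     [/\ (0 < cm)%N, mu = ef_mean rho Afun F th & tau = ef_mean rho Afun F t0]]); last first.
    (* Tuples that come from no admissible pair of parameters make the bound vacuous; any positive
       constants will do. *)
    exists (1, 1); rewrite /good => /andP[e0 e1]; split=> //= th t0 Tth Tt0 tht0 cm0 muE tauE.
    by exfalso; apply: no; exists th, t0.
  have [H [b [H0 b0 Hb]]] :=
    non_profitable_bound rho Afun th_lo th_hi F c efA th t0 eps cm Tth Tt0 tht0 eps0 c0 cm0.
  exists (H, b) => _; split => //= th' t0' Tth' Tt0' _ _ muE tauE.
  (* The mean determines the parameter, so constants obtained for one representative [th] serve
     every arm with that mean. *)
  have <- : th = th'.
    rewrite -(ef_mean_invK _ _ _ _ _ efA th Tth) muE; exact: ef_mean_invK.
  by move=> d T P cp C X n ct iidX ct0 n1 hct; exact: (Hb d T P cp).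
exists (fun eps cm mu tau => (f (eps, cm, mu, tau)).1),
  (fun eps cm mu tau => (f (eps, cm, mu, tau)).2).
split=> [eps cm mu tau /(fP (eps, cm, mu, tau))[]//|].
move=> d Omega P K theta tau cm cp C X [K2 Tth cmcp [Cb mC mX lawX ind]] a mutau
  [t0 Tt0 taue] eps eps01 T ct T1 /andP[ct1 ct2] hct.
have [_ _] := fP (eps, cm a, ef_mean rho Afun F (theta a), tau a) eps01.
have cm0 : (0 < cm a)%N by have /andP[] := cmcp a.
have tht0 : theta a < t0 by rewrite -(ef_mean_lt _ _ _ _ _ efA)// taue.
move=> /(_ (theta a) t0 (Tth a) Tt0 tht0 cm0 erefl (esym taue) d Omega P (cp a) (C a) (X a) T ct).
apply=> //.
- by split; [exact: (Cb a)|exact: (mC a)|exact: (mX a)|exact: (lawX a)|exact: (ind a)].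
- by apply: le_trans ct1.
Qed.
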